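(* Let $P_1,\dots,P_6$ be the joint invariants of $V_5\oplus V_3$ defined in the context. Put $(c_1,\dots,c_6)=(3,54,20432412,18,2270268,27027)$ and $(m_1,\dots,m_6)=(1,3,4,3,4,6)$. On the chart $D\ne0$ set $$U_i(F,G)=\frac{1}{c_i}\cdot\frac{P_i(F,G)}{D(F,G)^{m_i}}\qquad(1\le i\le 6).$$ Then the $U_i$ are absolute $\mathrm{SL}_2$-invariants and $$k(\mathcal{M}_4^1)=k(U_1,\dots,U_6).$$ In particular, $U_1,\dots,U_6$ are algebraically independent and give explicit birational coordinates on $\mathcal{M}_4^1$.
   Context: $k$ is an algebraically closed field of characteristic zero, $V_n$ is the space of binary forms of order (degree) $n$ in $x,y$ over $k$, and $\mathrm{SL}_2(k)$ acts on pairs $(F,G)\in V_5\oplus V_3$ by simultaneous linear substitution of variables. $\mathcal{R}=k[V_5\oplus V_3]^{\mathrm{SL}_2}$, graded by total degree. An absolute invariant is a quotient $P/Q$ of nonzero homogeneous elements of $\mathcal{R}$ of the same degree (or zero). $\mathcal{M}_4^1$ is the moduli space of degree-four rational maps $\varphi=[f_0:f_1]$ on $\mathbb{P}^1$ ($f_0,f_1\in V_4$, $\mathrm{Res}(f_0,f_1)\neq0$, up to common scalar) modulo $\mathrm{PGL}_2$-conjugation. Via $(F,G)=(yf_0-xf_1,(f_0)_x+(f_1)_y)$, it is the quotient of $\mathbb{P}(V_5\oplus V_3)\setminus\{\Delta_{F,G}=0\}$ by $\mathrm{PGL}_2$, where $\Delta_{F,G}=\mathrm{Res}(xG+F_y,yG-F_x)$,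 and its function field $k(\mathcal{M}_4^1)=\mathrm{Frac}(\mathcal{R})_0$ is the field of absolute invariants. Transvectants: for binary forms $A,B$ of orders $m,n$, $$(A,B)_r=\frac{(m-r)!(n-r)!}{m!\,n!}\sum_{j=0}^r(-1)^j\binom rj\frac{\partial^rA}{\partial x^{r-j}\partial y^j}\frac{\partial^rB}{\partial x^j\partial y^{r-j}}.$$ Covariants: $H=(F,F)_2$, $i=(F,F)_4$, $t=(F,H)_1$, $c_{3,5}=(i,F)_1$, $c_{3,3}=(i,F)_2$; $h=(G,G)_2$, $q=(G,h)_1$, $D=(h,h)_2$. Joint invariants: $A=(F,Gh)_5$, $L=(F,hq)_5$, $B_1=(i,h)_2$, $B_2=(H,G^2)_6$, $M=(H,Gq)_6$, $N=(H,q^2)_6$, $R=(c_{3,3},G)_3$, $S_1=(c_{3,3},q)_3$, $S_2=(c_{3,5},Gh)_5$, $S_3=(t,G^3)_9$, $T_1=(c_{3,5},hq)_5$, $T_2=(t,G^2q)_9$, $T_3=(F^3,G^5)_{15}$, $W=(F^3,G^4q)_{15}$. Numerators: $P_1=700A$; $P_2=5^3\bigl(98010L^2+190080DN+47045DA^2+97000D^2B_2-19224D^2B_1\bigr)$; $P_3=5^5\bigl(63868314510AL^2+49446437040DLM+148589040600DAN+31976059115DA^3+560560D^2T_3-164989440D^2T_2-45305310960D^2T_1+98893534740D^2AB_2-39968032104D^2AB_1+7720750752D^3R\bigr)$; $P_4=-5\bigl(632610L^2+803520DN+165385DA^2+552680D^2B_2-98424D^2B_1\bigr)$; $P_5=-5^3\bigl(216453026790AL^2+514942187760DLM+493336803960DAN+112492234855DA^3+83523440D^2T_3-16672803840D^2T_2-290479054320D^2T_1+491566054980D^2AB_2-218716874376D^2AB_1-12670582496D^3R\bigr)$;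 $P_6=-5^6\bigl(67988850930L^4+197785748160DL^2N+33952803885DA^2L^2-560560D^2LW+79622318160D^2L^2B_2-39182280984D^2L^2B_1+19394519760D^2ALM-82457760D^3LS_3+21320456220D^3LS_2+9857393568D^3LS_1\bigr)$. *)

(* Defs.v *)
From Stdlib Require Import BinNat.
From HB Require Import structures.
From mathcomp Require Import all_boot all_order all_algebra.
From mathcomp Require Import fraction mpoly.

Set Implicit Arguments.
Unset Strict Implicit.
Unset Printing Implicit Defensive.

Import GRing.Theory.
Local Open Scope ring_scope.

(* Ring numerals from binary literals: a ring_scope literal such as
   63868314510 would be expanded to a unary natural number. *)
Section BinaryNumerals.
Variable R : pzRingType.

Fixpoint posr (p : positive) : R :=
  match p with
  | xH => 1
  | xO q => posr q *+ 2
  | xI q => posr q *+ 2 + 1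
  end.

Definition binr (n : N) : R := if n is Npos p then posr p else 0.

Lemma binrE n : binr n = (nat_of_bin n)%:R.
Proof.
case: n => //=; elim=> [p IHp|p IHp|] //=;
  by rewrite NatTrec.doubleE -?natr1 -muln2 natrM mulr_natr IHp.
Qed.

End BinaryNumerals.

Arguments posr {R} p : simpl never.
Arguments binr {R} n : simpl never.

Notation "n %:B" := (binr n%num) (at level 1, left associativity, format "n %:B")
  : ring_scope.

(* Binary forms are polynomials in the two variables x = 'X_0, y = 'X_1.  The
   order of a form is passed explicitly where it is needed. *)
Section Forms.
Variable R : comUnitRingType.

(* the exponent of x^(n - i) y^i *)
Definition mon (n i : nat) : 'X_{1..2} :=
  (U_(ord0) *+ (n - i) + U_(ord_max) *+ i)%MM.

Definition form (n : nat) (a : 'I_n.+1 -> R) : {mpoly R[2]} :=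
  \sum_(i < n.+1) a i *: 'X_[mon n i].

(* The r-th transvectant of A of order m and B of order n; mon r j, used as a
   derivation multi-index, is d^r / dx^(r - j) dy^j. *)
Definition transvectant (m n r : nat) (A B : {mpoly R[2]}) : {mpoly R[2]} :=
  (((m - r)`!%:R * (n - r)`!%:R) / (m`!%:R * n`!%:R)) *:
    \sum_(j < r.+1)
      ((-1) ^+ j * 'C(r, j)%:R) *: (A^`M[mon r j] * B^`M[mon r (r - j)]).

(* Value in R of a transvectant of order m + n - 2r = 0. *)
Definition jinv (n : nat) (A B : {mpoly R[2]}) : R :=
  (transvectant n n n A B)@_0%MM.

Definition substf (g : 'M[R]_2) (A : {mpoly R[2]}) : {mpoly R[2]} :=
  A \mPo [tuple \sum_(j < 2) g i j *: 'X_j | i < 2].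

End Forms.

Section JointInvariants.
Variables (R : comUnitRingType) (F G : {mpoly R[2]}).

Definition covH := transvectant 5 5 2 F F.     (* order 6 *)
Definition covi := transvectant 5 5 4 F F.     (* order 2 *)
Definition covt := transvectant 5 6 1 F covH.  (* order 9 *)
Definition cov35 := transvectant 2 5 1 covi F. (* order 5 *)
Definition cov33 := transvectant 2 5 2 covi F. (* order 3 *)

Definition covh := transvectant 3 3 2 G G.     (* order 2 *)
Definition covq := transvectant 3 2 1 G covh.  (* order 3 *)

Definition jD : R := jinv 2 covh covh.
Definition jA : R := jinv 5 F (G * covh).
Definition jL : R := jinv 5 F (covh * covq).
Definition jB1 : R := jinv 2 covi covh.
Definition jB2 : R := jinv 6 covH (G ^+ 2).
Definition jM : R := jinv 6 covH (G * covq).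
Definition jN : R := jinv 6 covH (covq ^+ 2).
Definition jR : R := jinv 3 cov33 G.
Definition jS1 : R := jinv 3 cov33 covq.
Definition jS2 : R := jinv 5 cov35 (G * covh).
Definition jS3 : R := jinv 9 covt (G ^+ 3).
Definition jT1 : R := jinv 5 cov35 (covh * covq).
Definition jT2 : R := jinv 9 covt (G ^+ 2 * covq).
Definition jT3 : R := jinv 15 (F ^+ 3) (G ^+ 5).
Definition jW : R := jinv 15 (F ^+ 3) (G ^+ 4 * covq).

Definition P1 : R := 700%:B * jA.

Definition P2 : R := 5%:B ^+ 3 *
  (98010%:B * jL ^+ 2
   + 190080%:B * jD * jN
   + 47045%:B * jD * jA ^+ 2
   + 97000%:B * jD ^+ 2 * jB2
   - 19224%:B * jD ^+ 2 * jB1).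

Definition P3 : R := 5%:B ^+ 5 *
  (63868314510%:B * jA * jL ^+ 2
   + 49446437040%:B * jD * jL * jM
   + 148589040600%:B * jD * jA * jN
   + 31976059115%:B * jD * jA ^+ 3
   + 560560%:B * jD ^+ 2 * jT3
   - 164989440%:B * jD ^+ 2 * jT2
   - 45305310960%:B * jD ^+ 2 * jT1
   + 98893534740%:B * jD ^+ 2 * jA * jB2
   - 39968032104%:B * jD ^+ 2 * jA * jB1
   + 7720750752%:B * jD ^+ 3 * jR).

Definition P4 : R := - 5%:B *
  (632610%:B * jL ^+ 2
   + 803520%:B * jD * jN
   + 165385%:B * jD * jA ^+ 2
   + 552680%:B * jD ^+ 2 * jB2
   - 98424%:B * jD ^+ 2 * jB1).

Definition P5 : R := - 5%:B ^+ 3 *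
  (216453026790%:B * jA * jL ^+ 2
   + 514942187760%:B * jD * jL * jM
   + 493336803960%:B * jD * jA * jN
   + 112492234855%:B * jD * jA ^+ 3
   + 83523440%:B * jD ^+ 2 * jT3
   - 16672803840%:B * jD ^+ 2 * jT2
   - 290479054320%:B * jD ^+ 2 * jT1
   + 491566054980%:B * jD ^+ 2 * jA * jB2
   - 218716874376%:B * jD ^+ 2 * jA * jB1
   - 12670582496%:B * jD ^+ 3 * jR).

Definition P6 : R := - 5%:B ^+ 6 *
  (67988850930%:B * jL ^+ 4
   + 197785748160%:B * jD * jL ^+ 2 * jN
   + 33952803885%:B * jD * jA ^+ 2 * jL ^+ 2
   - 560560%:B * jD ^+ 2 * jL * jW
   + 79622318160%:B * jD ^+ 2 * jL ^+ 2 * jB2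
   - 39182280984%:B * jD ^+ 2 * jL ^+ 2 * jB1
   + 19394519760%:B * jD ^+ 2 * jA * jL * jM
   - 82457760%:B * jD ^+ 3 * jL * jS3
   + 21320456220%:B * jD ^+ 3 * jL * jS2
   + 9857393568%:B * jD ^+ 3 * jL * jS1).

Definition P_ : 6.-tuple R := [tuple P1; P2; P3; P4; P5; P6].

End JointInvariants.

(* A pair (F, G) in V_5 + V_3 is given by its 6 + 4 coefficients, so that
   k[V_5 + V_3] is {mpoly k[6 + 4]}, graded by total degree. *)
Section Pairs.
Variable R : comUnitRingType.

Definition quintic (v : 'I_(6 + 4) -> R) : {mpoly R[2]} :=
  form (fun i : 'I_6 => v (lshift 4 i)).

Definition cubic (v : 'I_(6 + 4) -> R) : {mpoly R[2]} :=
  form (fun i : 'I_4 => v (rshift 6 i)).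

Definition subst_pair (g : 'M[R]_2) (v : 'I_(6 + 4) -> R) : 'I_(6 + 4) -> R :=
  fun i => match split i with
           | inl j => (substf g (quintic v))@_(mon 5 j)
           | inr j => (substf g (cubic v))@_(mon 3 j)
           end.

End Pairs.

Section ModuliField.
Variable k : closedFieldType.

Local Notation S := {mpoly k[6 + 4]}.
Local Notation K := {fraction S}.

Definition SL2_invariant (P : S) : Prop :=
  forall (g : 'M[k]_2) (v : 'I_(6 + 4) -> k),
    \det g = 1 -> P.@[subst_pair g v] = P.@[v].

Definition absolute_invariant (f : K) : Prop :=
  exists (d : nat) (P Q : S),
    [/\ P \is d.-homog /\ SL2_invariant P,
        Q \is d.-homog /\ SL2_invariant Q,
        Q != 0
      & f = tofrac P / tofrac Q].

(* The function field of M_4^1, as the subfield Frac(R)_0 of k(V_5 + V_3). *)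
Definition function_field_M41 (f : K) : Prop := absolute_invariant f.

Definition scalar (c : k) : K := tofrac (c%:MP_[6 + 4]).

(* p(u_1, ..., u_n) *)
Definition evalK (n : nat) (u : 'I_n -> K) (p : {mpoly k[n]}) : K :=
  mmap scalar u p.

(* f lies in k(u_1, ..., u_n) *)
Definition generated_field (n : nat) (u : 'I_n -> K) (f : K) : Prop :=
  exists p q : {mpoly k[n]}, evalK u q != 0 /\ f = evalK u p / evalK u q.

Definition algebraically_independent (n : nat) (u : 'I_n -> K) : Prop :=
  forall p : {mpoly k[n]}, evalK u p = 0 -> p = 0.

(* The rational map M_4^1 --> A^n with components u is birational: pulling back
   the coordinates X_i to u_i is an isomorphism of k(A^n) onto k(M_4^1). *)
Definition birational_coordinates (n : nat) (u : 'I_n -> K) : Prop :=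
  exists phi : {rmorphism {fraction {mpoly k[n]}} -> K},
    [/\ forall c : k, phi (tofrac c%:MP_[n]) = scalar c,
        forall i : 'I_n, phi (tofrac 'X_i) = u i,
        injective phi
      & forall f : K, function_field_M41 f <-> exists g, phi g = f].

(* The generic pair: its coefficients are the coordinate functions. *)
Definition genF : {mpoly S[2]} := quintic (fun i => 'X_i : S).
Definition genG : {mpoly S[2]} := cubic (fun i => 'X_i : S).

Definition c_ : 6.-tuple K :=
  [tuple 3%:B; 54%:B; 20432412%:B; 18%:B; 2270268%:B; 27027%:B].

Definition m_ : 6.-tuple nat := [tuple 1; 3; 4; 3; 4; 6]%N.

Definition U (i : 'I_6) : K :=
  (tnth c_ i)^-1 * (tofrac (tnth (P_ genF genG) i) / tofrac (jD genG) ^+ tnth m_ i).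

End ModuliField.

(* Main.v *)
(* A binary cubic of nonzero discriminant is, up to a scalar, SL_2-equivalent to
   [G_0 = x^3 + y^3].  So a homogeneous invariant of [V_5 + V_3] is determined by its
   restriction to the slice [G = G_0], and a quotient of two invariants of the same
   degree restricts to a rational function on [V_5] invariant under the stabilizer of
   the line of [G_0], which acts through the symmetric group S_3.  In suitable
   coordinates [s, p, u, w, v, z] on [V_5], S_3 is generated by a rotation, which
   multiplies [u, v] by a primitive cube root of unity and [w, z] by its inverse, and
   a swap [u <-> w, v <-> z, p |-> - p].  On the slice the [U_i] are, up to an
   invertible linear change of coordinates,
     [s], [u w], [u^3 + w^3], [u z + v w], [u^2 v + w^2 z], [p (u^3 - w^3)].
   The second and third are the invariants of the plane [u, w]; given [u] and [w], the
   last three are linear in [v, z, p] with determinant a power of [u^3 - w^3].  Hence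
   the [U_i] generate the field of invariants, and the map they define is
   generically onto, which makes them algebraically independent. *)
From Stdlib Require Import BinNat.
From HB Require Import structures.
From mathcomp Require Import all_boot all_order all_algebra.
From mathcomp Require Import fraction mpoly ring zify.
Require Import Defs.
Set Implicit Arguments.
Unset Strict Implicit.
Unset Printing Implicit Defensive.
Import GRing.Theory.
Local Open Scope ring_scope.

(** * Coefficient lists of binary forms *)

(** The large coefficients of [P2], ..., [P6] are those for which all but a few monomials cancel on
    the slice. There [jD] equals -2, whence the powers of -2 between the numerators and the values
    of the [U i]. The descent by S_3 uses pointwise identities instead of Galois theory. Averaging
    over rotations leaves, up to a power of [delta], a function x + y alt, with x, y polynomials in
    the [U i] and alt = u^3 - w^3. The swap is realized in determinant 1 by a matrix with entries j,
    j^2 = -1, which carries G_0 to -j G_0; so an invariant of degree d is not fixed by the swap but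
    picks up (-j)^d. This factor is common to P and Q in an absolute invariant P/Q, so the quotient
    can be rationalized: multiplying both terms by the swapped Q removes alt. To return from the
    slice to all pairs, both sides of a cross-multiplied identity are brought to the same degree by
    powers of [D]. *)

Section CoefficientLists.
Variable R : comUnitRingType.
Implicit Types s t : seq R.

Definition X2 : {mpoly R[2]} := 'X_ord0.
Definition Y2 : {mpoly R[2]} := 'X_ord_max.

(* The form [s_0 x^n + s_1 x^(n-1) y + ... + s_n y^n], where [n = size s - 1]. *)
Fixpoint dform s : {mpoly R[2]} :=
  if s is c :: s' then c *: X2 ^+ size s' + Y2 * dform s' else 0.

(** Truncates at the shorter list, so summands must be padded to equal length, as [mull] and
    [transl] do. *)
Fixpoint addl s t : seq R :=
  match s, t with
  | a :: s', b :: t' => a + b :: addl s' t'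
  | _, _ => [::]
  end.

Definition scalel (c : R) s := [seq c * a | a <- s].

(** The padding of the empty case makes the length [(size s + size t).-1] for every [s] and nonempty
    [t]: orders add. *)
Fixpoint mull s t : seq R :=
  if s is a :: s' then addl (scalel a t ++ nseq (size s') 0) (0 :: mull s' t)
  else nseq (size t).-1 0.

Fixpoint dxl s : seq R :=
  if s is c :: s' then
    if s' is [::] then [::] else c *+ size s' :: dxl s'
  else [::].

(** [i] is the exponent of y at the head before differentiation. *)
Fixpoint dyl_from (i : nat) s : seq R :=
  if s is c :: s' then c *+ i :: dyl_from i.+1 s' else [::].

Definition dyl s := dyl_from 1 (behead s).

Lemma monE n i : 'X_[mon n i] = X2 ^+ (n - i) * Y2 ^+ i.
Proof. by rewrite /mon mpolyXD /X2 /Y2 !mpolyXn. Qed.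

Lemma form_nth n s :
  size s = n.+1 -> form (fun i : 'I_n.+1 => s`_i) = dform s.
Proof.
elim: n s => [|n IH] [|c s] //= [sz]; rewrite /form big_ord_recl /=.
  case: s sz => // _; rewrite big_ord0 mulr0 !addr0 expr0.
  by rewrite monE !expr0 mulr1.
rewrite monE subn0 expr0 mulr1 sz -(IH s sz) /form mulr_sumr; congr (_ + _).
apply: eq_bigr => i _ /=; rewrite /bump /= add1n -scalerAr; congr (_ *: _).
by rewrite !monE subSS exprS [RHS]mulrCA.
Qed.

Lemma dform_coef s j : (j < size s)%N -> (dform s)@_(mon (size s).-1 j) = s`_j.
Proof.
case: s => [|c s] // lt_j; rewrite -(@form_nth (size s)) // /form.
rewrite raddf_sum /= (bigD1 (Ordinal lt_j)) //= mcoeffZ mcoeffX eqxx mulr1.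
rewrite big1 ?addr0 // => i /eqP neq_i; rewrite mcoeffZ mcoeffX.
case: eqP => [/mnmP /(_ ord_max)|_]; rewrite ?mulr0 // !mnmDE !mulmnE !mnm1E /=.
by rewrite !mul0n !mul1n !add0n => eq_ij; case: neq_i; apply: val_inj.
Qed.

Lemma size_addl s t : size s = size t -> size (addl s t) = size s.
Proof. by elim: s t => [|? s IH] [|? t] //= [/IH ->]. Qed.

Lemma dform_add s t : size s = size t -> dform (addl s t) = dform s + dform t.
Proof.
elim: s t => [|a s IH] [|b t] //=; first by rewrite addr0.
move=> [sz]; rewrite IH // size_addl // sz scalerDl mulrDr.
by rewrite addrACA.
Qed.

Lemma dform_scale c s : dform (scalel c s) = c *: dform s.
Proof.
elim: s => [|a s IH] /=; first by rewrite scaler0.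
by rewrite size_map IH scalerDr scalerA scalerAr.
Qed.

Lemma dform_nseq0 s n : dform (s ++ nseq n 0) = X2 ^+ n * dform s.
Proof.
elim: s => [|a s IH] /=.
  rewrite mulr0; elim: n => //= n IH; by rewrite IH mulr0 scale0r addr0.
by rewrite IH size_cat size_nseq addnC exprD [RHS]mulrDr -scalerAr mulrCA.
Qed.

Lemma mull_cons a s t :
  mull (a :: s) t = addl (scalel a t ++ nseq (size s) 0) (0 :: mull s t).
Proof. by []. Qed.

Lemma dform_nseq n : dform (nseq n 0) = 0.
Proof. by rewrite -[nseq _ _]/([::] ++ _) dform_nseq0 mulr0. Qed.

Lemma size_mull s t : (0 < size t)%N -> size (mull s t) = (size s + size t).-1.
Proof.
move=> t_gt0; elim: s => [|a s IH]; first by rewrite size_nseq.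
by rewrite mull_cons size_addl size_cat size_nseq size_map /= ?IH; lia.
Qed.

Lemma dform_mul s t : (0 < size t)%N -> dform (mull s t) = dform s * dform t.
Proof.
move=> t_gt0; elim: s => [|a s IH].
  by rewrite /= mul0r dform_nseq.
rewrite mull_cons dform_add; last first.
  by rewrite size_cat size_nseq size_map /= size_mull; lia.
rewrite dform_nseq0 dform_scale [dform (0 :: _)]/= scale0r add0r IH.
by rewrite [dform (a :: _)]/= mulrDl -scalerAl -scalerAr mulrA.
Qed.

Lemma mderiv_exp (i : 'I_2) (p : {mpoly R[2]}) n :
  (p ^+ n)^`M(i) = (p ^+ n.-1 * p^`M(i)) *+ n.
Proof.
elim: n => [|n IH]; first by rewrite expr0 mulr0n -mpolyC1 mderivC.
rewrite exprS mderivM IH; case: n {IH} => [|n] /=.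
  by rewrite mulr0n mulr0 addr0 mulr1n expr0 mulr1 mul1r.
by rewrite mulrnAr mulrA -exprS [p^`M(i) * _]mulrC -mulrS.
Qed.

Lemma mderivXU n (i j : 'I_n) : ('X_i : {mpoly R[n]})^`M(j) = (i == j)%:R.
Proof.
rewrite mderivX mnm1E; case: eqP => [->|_]; last by rewrite scale0r.
by rewrite scale1r -[X in (X - _)%MM]add0m addmK mpolyX0.
Qed.

Lemma size_dxl s : size (dxl s) = (size s).-1.
Proof. by elim: s => //= a [|b s] //= ->. Qed.

Lemma mderiv_dxl s : (dform s)^`M(ord0) = dform (dxl s).
Proof.
elim: s => [|a s IH]; first by rewrite /= -mpolyC0 mderivC.
rewrite [dform (a :: s)]/= mderivD mderivZ mderivM IH mderiv_exp /X2 /Y2.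
rewrite !mderivXU /= mul0r add0r mulr1.
case: s {IH} => [|b s]; first by rewrite mulr0n scaler0 mulr0 addr0.
by rewrite [RHS]/= -/(dxl (b :: s)) size_dxl -scalerMnr scalerMnl.
Qed.

(** For i > 0 this is the y-derivative of [Y2 ^+ i * dform s] divided by [Y2 ^+ i.-1]; the induction
    needs a general [i]. *)
Lemma dform_dyl_from i s :
  dform (dyl_from i s) = dform s *+ i + Y2 * (dform s)^`M(ord_max).
Proof.
elim: s i => [|a s IH] i; first by rewrite /= -mpolyC0 mderivC mulr0 mul0rn addr0.
rewrite [dform (a :: s)]/= mderivD mderivZ mderivM mderiv_exp /X2.
rewrite !mderivXU /= mulr0 mul0rn scaler0 add0r.
have sz_dyl j t : size (dyl_from j t) = size t by elim: t j => //= c t IH' j; rewrite IH'.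
rewrite mul1r sz_dyl IH mulrnDl -scalerMnl -addrA; congr (_ + _).
by rewrite !mulrDr addrA mulrS mulrDr mulrnAr [_ *+ i + _]addrC.
Qed.

Lemma mderiv_dyl s : (dform s)^`M(ord_max) = dform (dyl s).
Proof.
case: s => [|a s]; first by rewrite /= -mpolyC0 mderivC.
rewrite /dyl /= dform_dyl_from mulr1n mderivD mderivZ mderivM mderiv_exp /X2 /Y2.
rewrite !mderivXU /= mulr0 mul0rn scaler0 add0r.
by rewrite mul1r.
Qed.

Lemma mderivm_dform r j s : (j <= r)%N ->
  (dform s)^`M[mon r j] = dform (iter j dyl (iter (r - j) dxl s)).
Proof.
move=> _; rewrite /mon mderivmDm !mderivn_iter.
have ->: iter (r - j) (mderiv ord0) (dform s) = dform (iter (r - j) dxl s).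
  by elim: (r - j)%N => //= n ->; rewrite mderiv_dxl.
by elim: j {s} (iter _ _ s) => //= n IH s; rewrite IH mderiv_dyl.
Qed.

Lemma size_dyl s : size (dyl s) = (size s).-1.
Proof.
case: s => // a s; rewrite /dyl /=.
by elim: s 1%N => //= b s IH i; rewrite IH.
Qed.

(* The list of the transvectant without its normalizing factor. *)
Definition transl (r : nat) s t : seq R :=
  foldr (fun j acc => addl (scalel ((-1) ^+ j * 'C(r, j)%:R)
     (mull (iter j dyl (iter (r - j) dxl s))
           (iter (r - j) dyl (iter j dxl t)))) acc)
   (nseq (size s + size t - (r + r)).-1 0) (iota 0 r.+1).

Lemma transvectant_dform m n r s t :
  (r < size s)%N -> (r < size t)%N ->
  transvectant m n r (dform s) (dform t) =
  (((m - r)`!%:R * (n - r)`!%:R) / (m`!%:R * n`!%:R)) *: dform (transl r s t).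
Proof.
move=> ls lt; rewrite /transvectant; congr (_ *: _).
rewrite -(big_mkord xpredT (fun j => ((-1) ^+ j * 'C(r, j)%:R) *:
  ((dform s)^`M[mon r j] * (dform t)^`M[mon r (r - j)]))).
rewrite /index_iota subn0 /transl.
have sz_iter (f : seq R -> seq R) : (forall u, size (f u) = (size u).-1) ->
    forall i u, size (iter i f u) = (size u - i)%N.
  by move=> fE; elim=> [|i IH] u; rewrite ?subn0 //= fE IH; lia.
set N := (size s + size t - (r + r)).-1.
have: all (fun j => j < r.+1)%N (iota 0 r.+1).
  by apply/allP=> j; rewrite mem_iota.
(* The induction runs over any list of indices and carries the length along, since [dform_add] needs
   equal lengths. *)
suff H : forall l, all (fun j => j < r.+1)%N l ->
    let u := foldr (fun j acc => addl (scalel ((-1) ^+ j * 'C(r, j)%:R)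
     (mull (iter j dyl (iter (r - j) dxl s))
           (iter (r - j) dyl (iter j dxl t)))) acc) (nseq N 0) l in
    \sum_(j <- l) ((-1) ^+ j * 'C(r, j)%:R) *:
       ((dform s)^`M[mon r j] * (dform t)^`M[mon r (r - j)])
    = dform u /\ size u = N.
  by case/H.
elim=> [_|j l IH /=/andP [le_jr /IH [{}IH sz]]].
  by rewrite big_nil /= dform_nseq size_nseq.
have szj : size (mull (iter j dyl (iter (r - j) dxl s))
           (iter (r - j) dyl (iter j dxl t))) = N.
  rewrite size_mull !(sz_iter _ size_dyl) !(sz_iter _ size_dxl) /N; lia.
rewrite big_cons dform_add ?size_addl ?sz ?size_map //.
rewrite IH dform_scale dform_mul; last first.
  rewrite !(sz_iter _ size_dyl) !(sz_iter _ size_dxl); lia.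
by rewrite !mderivm_dform ?leq_subr // subKn.
Qed.

Lemma mcoeff0_mderivm r j (A : {mpoly R[2]}) : (j <= r)%N ->
  (A^`M[mon r j])@_0%MM = A@_(mon r j) * (j`! * (r - j)`!)%:R.
Proof.
move=> _; rewrite mcoeff_mderivm addm0 mulr_natr mulnC; congr (_ *+ _).
rewrite big_ord_recl big_ord1 /mon !mnmDE !mulmnE !mnm1E /=.
by rewrite !mul1n !mul0n addn0 !ffactnn.
Qed.

(** Each full derivative isolates one coefficient, times j! (n - j)!; dividing the two factors by
    the square of n! leaves one inverse binomial. *)
Lemma jinvE n (A B : {mpoly R[2]}) : (n`!%:R : R) \is a GRing.unit ->
  jinv n A B =
  \sum_(j < n.+1) (-1) ^+ j * (A@_(mon n j) * B@_(mon n (n - j))) / 'C(n, j)%:R.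
Proof.
move=> Un; rewrite /jinv /transvectant mcoeffZ subnn fact0 mul1r linear_sum.
rewrite mulr_sumr; apply: eq_bigr => j _ /=.
have le_jn : (j <= n)%N by rewrite -ltnS.
have En : n`!%:R = 'C(n, j)%:R * (j`! * (n - j)`!)%:R :> R.
  by rewrite -natrM bin_fact.
have /andP[UC Uf] : (('C(n, j)%:R : R) \is a GRing.unit)
   && (((j`! * (n - j)`!)%:R : R) \is a GRing.unit) by rewrite -unitrM -En.
rewrite mcoeffZ rmorphM /= !mcoeff0_mderivm ?leq_subr // subKn //.
rewrite mul1r En invrM ?unitrM ?UC ?Uf // !invrM //.
rewrite [((n - j)`! * _)%N]mulnC.
set f := (j`! * (n - j)`!)%:R; set c := 'C(n, j)%:R; set e := (-1) ^+ j.
have fV : f^-1 * f = 1 by rewrite mulVr.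
have cV : c^-1 * c = 1 by rewrite mulVr.
move: (A@__) (B@__) f c e fV cV => a b f c e fV cV.
transitivity ((f^-1 * f) * (f^-1 * f) * (c^-1 * c) * (e * (a * b) * c^-1)).
  by ring.
by rewrite fV cV !mul1r.
Qed.

End CoefficientLists.

Arguments dform {R} s : simpl never.

(** * Transvectants and substitutions *)

Lemma mpoly_ring_ind n (R : comNzRingType) (Q : {mpoly R[n]} -> Prop) :
  (forall c, Q c%:MP) -> (forall i, Q 'X_i) ->
  (forall p q, Q p -> Q q -> Q (p + q)) ->
  (forall p q, Q p -> Q q -> Q (p * q)) -> forall p, Q p.
Proof.
move=> QC QX QD QM; elim/mpolyind => [|c m p _ _ Qp]; first by rewrite -mpolyC0.
apply: (QD) => //; rewrite -mul_mpolyC; apply: (QM) => //.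
rewrite mpolyXE_id; apply: (big_ind Q) => [|p1 p2|i _];
  [by rewrite -mpolyC1 | exact: QM |].
by elim: (m i) => [|e IH]; rewrite ?expr0 -?mpolyC1 // exprS; apply: (QM).
Qed.

(** Inductive step of [omega_substf]: the scalars a, b, c, d are entries of the matrix, e is the
    power of its determinant already extracted, and the xx and yy terms cancel. *)
Lemma determinant_expansion (R : comNzRingType) (V : lmodType R)
    (a b c d e : R) (xx xy yx yy : V) :
  a *: (c *: (e *: xx) + d *: (e *: xy)) + b *: (c *: (e *: yx) + d *: (e *: yy)) -
  (c *: (a *: (e *: xx) + b *: (e *: xy)) + d *: (a *: (e *: yx) + b *: (e *: yy))) =
  (e * (a * d - c * b)) *: (xy - yx).
Proof.
have cancel (x x' y y' y1 y1' : V) :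
    x + y + (y' + x') - (x + y1 + (y1' + x')) = (y - y1) + (y' - y1').
  rewrite opprD addrACA; congr (_ + _).
    by rewrite opprD addrACA subrr add0r.
  by rewrite opprD addrACA subrr addr0.
rewrite !scalerDr !scalerA [c * a]mulrC [d * b]mulrC cancel.
by rewrite scalerN -scaleNr -!scalerBl; congr (_ *: _ + _ *: _); ring.
Qed.

Lemma det_mx22 (R : comNzRingType) (g : 'M[R]_2) :
  \det g = g ord0 ord0 * g ord_max ord_max - g ord0 ord_max * g ord_max ord0.
Proof.
rewrite (expand_det_row _ ord0) big_ord_recl big_ord1 /cofactor !det_mx11 !mxE /=.
rewrite expr0 expr1 mul1r mulN1r mulrN.
have -> : lift ord0 ord0 = ord_max :> 'I_2 by apply: val_inj.
by have -> : lift ord_max ord0 = ord0 :> 'I_2 by apply: val_inj.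
Qed.

Section Transvectants.
Variable R : comUnitRingType.
Implicit Types A B : {mpoly R[2]}.

(** The r-th power of Cayley's Omega operator, that is, the transvectant without its scalar. *)
Definition omega r A B : {mpoly R[2]} :=
  \sum_(j < r.+1)
    ((-1) ^+ j * 'C(r, j)%:R) *: (A^`M[mon r j] * B^`M[mon r (r - j)]).

Lemma transvectantE m n r A B : transvectant m n r A B =
  (((m - r)`!%:R * (n - r)`!%:R) / (m`!%:R * n`!%:R)) *: omega r A B.
Proof. by []. Qed.

Lemma omegaDl r A A' B : omega r (A + A') B = omega r A B + omega r A' B.
Proof.
rewrite /omega -big_split; apply: eq_bigr => j _ /=.
by rewrite mderivmD mulrDl scalerDr.
Qed.

Lemma omegaDr r A B B' : omega r A (B + B') = omega r A B + omega r A B'.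
Proof.
rewrite /omega -big_split; apply: eq_bigr => j _ /=.
by rewrite mderivmD mulrDr scalerDr.
Qed.

Lemma omegaZl r c A B : omega r (c *: A) B = c *: omega r A B.
Proof.
rewrite /omega scaler_sumr; apply: eq_bigr => j _ /=.
by rewrite mderivmZ -scalerAl !scalerA mulrC.
Qed.

Lemma omegaZr r c A B : omega r A (c *: B) = c *: omega r A B.
Proof.
rewrite /omega scaler_sumr; apply: eq_bigr => j _ /=.
by rewrite mderivmZ -scalerAr !scalerA mulrC.
Qed.

Lemma omega0 A B : omega 0 A B = A * B.
Proof. by rewrite /omega big_ord1 mul1r scale1r /mon !subnn !mulm0n addm0 !mderivm0m. Qed.

Lemma omega_bilinear r a b c d A A' B B' :
  omega r (a *: A + b *: A') (c *: B + d *: B') =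
  a *: (c *: omega r A B + d *: omega r A B') +
  b *: (c *: omega r A' B + d *: omega r A' B').
Proof. by rewrite omegaDl !omegaZl !omegaDr !omegaZr. Qed.

Lemma mderiv_monx r j A : (j <= r)%N ->
  (A^`M(ord0))^`M[mon r j] = A^`M[mon r.+1 j].
Proof.
move=> le_jr; rewrite /mon subSn // mulmS -addmA [RHS]mderivmDm.
by rewrite mderivmU1m.
Qed.

Lemma mderiv_mony r j A : (A^`M(ord_max))^`M[mon r j] = A^`M[mon r.+1 j.+1].
Proof.
have ->: mon r.+1 j.+1 = (U_(ord_max) + mon r j)%MM.
  by apply/mnmP=> i; rewrite !mnmDE !mulmnE subSS !mnm1E; lia.
by rewrite mderivmDm mderivmU1m.
Qed.

(** Pascal's rule; the first sum on the right is extended by the index [r.+1], where the binomial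
    vanishes. *)
Lemma alternating_binomialS r (a : nat -> {mpoly R[2]}) :
  \sum_(j < r.+2) ((-1) ^+ j * 'C(r.+1, j)%:R : R) *: a j =
  \sum_(j < r.+1) ((-1) ^+ j * 'C(r, j)%:R : R) *: a j -
  \sum_(j < r.+1) ((-1) ^+ j * 'C(r, j)%:R : R) *: a j.+1.
Proof.
have ->: \sum_(j < r.+1) ((-1) ^+ j * 'C(r, j)%:R : R) *: a j =
    \sum_(j < r.+2) ((-1) ^+ j * 'C(r, j)%:R : R) *: a j.
  by rewrite [RHS]big_ord_recr /= bin_small // mulr0 scale0r addr0.
rewrite [LHS]big_ord_recl [X in _ = X - _]big_ord_recl !bin0.
rewrite -addrA -sumrB; congr (_ + _); apply: eq_bigr => j _.
rewrite -[nat_of_ord (lift _ _)]/(j.+1).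
by rewrite binS natrD mulrDr scalerDl exprS mulN1r !mulNr !scaleNr.
Qed.

(** Splits one factor off the power of the Omega operator, which makes covariance provable by
    induction. *)
Lemma omegaS r A B : omega r.+1 A B =
  omega r A^`M(ord0) B^`M(ord_max) - omega r A^`M(ord_max) B^`M(ord0).
Proof.
pose a j := A^`M[mon r.+1 j] * B^`M[mon r.+1 (r.+1 - j)].
rewrite /omega (alternating_binomialS r a).
congr (_ - _); apply: eq_bigr => j _;
  congr (_ *: _); have le_jr : (j <= r)%N by rewrite -ltnS.
- by rewrite /a mderiv_monx // mderiv_mony subSn.
- by rewrite /a mderiv_mony mderiv_monx ?leq_subr // subSS.
Qed.

Lemma mderiv_comp (lq : 2.-tuple {mpoly R[2]}) A (i : 'I_2) :
  (A \mPo lq)^`M(i) = \sum_l (A^`M(l) \mPo lq) * (tnth lq l)^`M(i).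
Proof.
elim/mpoly_ring_ind: A => [c|j|A B IHA IHB|A B IHA IHB].
- by rewrite comp_mpolyC mderivC big1 // => l _; rewrite mderivC comp_mpolyC mul0r.
- rewrite comp_mpolyXU (bigD1 j) //= mderivXU eqxx rmorph1 mul1r -tnth_nth.
  rewrite big1 ?addr0 // => l /negbTE neq_lj.
  by rewrite mderivXU eq_sym neq_lj rmorph0 mul0r.
- rewrite rmorphD !mderivD IHA IHB -big_split; apply: eq_bigr => l _ /=.
  by rewrite mderivD rmorphD mulrDl.
rewrite rmorphM !mderivM IHA IHB mulr_suml mulr_sumr -big_split.
apply: eq_bigr => l _ /=; rewrite mderivM rmorphD !rmorphM mulrDl.
by rewrite mulrAC mulrA.
Qed.

Lemma mderiv_substf (g : 'M[R]_2) A (i : 'I_2) :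
  (substf g A)^`M(i) =
  g ord0 i *: substf g A^`M(ord0) + g ord_max i *: substf g A^`M(ord_max).
Proof.
rewrite /substf mderiv_comp big_ord_recl big_ord1 !tnth_mktuple.
have lin l : (\sum_(j < 2) g l j *: 'X_j)^`M(i) = (g l i)%:MP :> {mpoly R[2]}.
  rewrite linear_sum (bigD1 i) //= mderivZ mderivXU eqxx big1 => [|j ne_ji].
    by rewrite addr0 alg_mpolyC.
  by rewrite mderivZ mderivXU (negbTE ne_ji) scaler0.
rewrite !lin -!mul_mpolyC ![_%:MP * _]mulrC.
have -> : lift ord0 ord0 = ord_max :> 'I_2 by apply: val_inj.
by [].
Qed.

(** By the chain rule [mderiv_substf], each use of [omegaS] contributes one determinant. *)
Lemma omega_substf (g : 'M[R]_2) r A B :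
  omega r (substf g A) (substf g B) = \det g ^+ r *: substf g (omega r A B).
Proof.
elim: r A B => [|r IH] A B; first by rewrite !omega0 scale1r /substf rmorphM.
rewrite [LHS]omegaS !(mderiv_substf g) !omega_bilinear !IH determinant_expansion.
rewrite exprSr -det_mx22 omegaS; congr (_ *: _); by rewrite /substf rmorphB.
Qed.

Lemma transvectant_substf m n r (g : 'M[R]_2) A B : \det g = 1 ->
  transvectant m n r (substf g A) (substf g B) = substf g (transvectant m n r A B).
Proof.
move=> det1; rewrite !transvectantE omega_substf det1 expr1n scale1r.
by rewrite /substf linearZ.
Qed.

End Transvectants.

(** * Compatibility of the joint invariants with ring morphisms *)

Section InvariantMorphism.
Variables (R S : comUnitRingType) (f : {rmorphism R -> S}).
Variable (Phi : {rmorphism {mpoly R[2]} -> {mpoly S[2]}}).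
Hypothesis Phi_transvectant : forall m n r A B,
  Phi (transvectant m n r A B) = transvectant m n r (Phi A) (Phi B).
Hypothesis Phi_coef0 : forall A, (Phi A)@_0%MM = f A@_0%MM.

Let Phi_jinv n A B : jinv n (Phi A) (Phi B) = f (jinv n A B).
Proof. by rewrite /jinv -Phi_transvectant Phi_coef0. Qed.

Let f_binr n : f (binr n) = binr n.
Proof. by rewrite !binrE rmorph_nat. Qed.

Let fE := (f_binr, rmorphM f, rmorphN f, rmorphXn f, rmorphB f, rmorphD f).

Lemma jD_morph G : jD (Phi G) = f (jD G).
Proof. by rewrite /jD /covh -!Phi_transvectant Phi_jinv. Qed.

(** The numerators are built from transvectants, products and integers. The lemma serves twice: with
    [Phi] a substitution and [f] the identity, and with [Phi] the action of [f] on coefficients. *)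
Lemma P_morph F G i :
  tnth (P_ (Phi F) (Phi G)) i = f (tnth (P_ F G) i).
Proof.
have jE : (jA (Phi F) (Phi G) = f (jA F G)) * (jL (Phi F) (Phi G) = f (jL F G))
  * (jB1 (Phi F) (Phi G) = f (jB1 F G)) * (jB2 (Phi F) (Phi G) = f (jB2 F G))
  * (jM (Phi F) (Phi G) = f (jM F G)) * (jN (Phi F) (Phi G) = f (jN F G))
  * (jR (Phi F) (Phi G) = f (jR F G)) * (jS1 (Phi F) (Phi G) = f (jS1 F G))
  * (jS2 (Phi F) (Phi G) = f (jS2 F G)) * (jS3 (Phi F) (Phi G) = f (jS3 F G))
  * (jT1 (Phi F) (Phi G) = f (jT1 F G)) * (jT2 (Phi F) (Phi G) = f (jT2 F G))
  * (jT3 (Phi F) (Phi G) = f (jT3 F G)) * (jW (Phi F) (Phi G) = f (jW F G)).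
  by do !split; rewrite /jA /jL /jB1 /jB2 /jM /jN /jR /jS1 /jS2 /jS3 /jT1 /jT2
    /jT3 /jW /cov33 /cov35 /covt /covi /covH /covq /covh
    -?Phi_transvectant -?rmorphXn -?rmorphM -?Phi_transvectant -?rmorphM
    -?Phi_transvectant -?rmorphM Phi_jinv.
case: i => [[|[|[|[|[|[|i]]]]]] //= lt_i6]; rewrite !(tnth_nth 0) /=.
- by rewrite /P1 !jE !fE.
- by rewrite /P2 !jE jD_morph !fE.
- by rewrite /P3 !jE jD_morph !fE.
- by rewrite /P4 !jE jD_morph !fE.
- by rewrite /P5 !jE jD_morph !fE.
- by rewrite /P6 !jE jD_morph !fE.
Qed.

End InvariantMorphism.

(** Turns a constant term into the value at the origin, a point fixed by linear substitutions. *)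
Lemma mcoeff0_meval n (R : comNzRingType) (p : {mpoly R[n]}) :
  p@_0%MM = p.@[fun=> 0].
Proof.
elim/mpoly_ring_ind: p => [c|i|p q IHp IHq|p q IHp IHq].
- by rewrite mcoeffC eqxx mulr1 mevalC.
- by rewrite mevalXU mcoeffX mnm1_eq0.
- by rewrite mcoeffD mevalD IHp IHq.
by rewrite mevalM rmorphM /= IHp IHq.
Qed.

Section SubstitutionInvariance.
Variables (R : comUnitRingType) (g : 'M[R]_2).
Hypothesis det_g : \det g = 1.

Let lg : 2.-tuple {mpoly R[2]} := [tuple \sum_(j < 2) g i j *: 'X_j | i < 2].

Lemma meval_substf A v : (substf g A).@[v] = A.@[fun i => \sum_j g i j * v j].
Proof.
rewrite /substf comp_mpoly_meval; apply: meval_eq => i.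
by rewrite tnth_mktuple raddf_sum /=; apply: eq_bigr => j _; rewrite mevalZ mevalXU.
Qed.

Lemma substf_coef0 A : (substf g A)@_0%MM = A@_0%MM.
Proof.
rewrite !mcoeff0_meval meval_substf; apply: meval_eq => i.
by rewrite big1 // => j _; rewrite mulr0.
Qed.

Lemma P_substf F G i : tnth (P_ (substf g F) (substf g G)) i = tnth (P_ F G) i.
Proof.
apply: (P_morph (f := idfun) (Phi := comp_mpoly lg)) => [m n r A B|A].
  by rewrite transvectant_substf.
exact: substf_coef0.
Qed.

Lemma jD_substf G : jD (substf g G) = jD G.
Proof.
apply: (jD_morph (f := idfun) (Phi := comp_mpoly lg)).
  by move=> m n r A B; rewrite transvectant_substf.
exact: substf_coef0.
Qed.

End SubstitutionInvariance.

(** * Specialization of the coefficients *)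

Section CoefficientMorphism.
Variables (R S : comUnitRingType) (f : {rmorphism R -> S}).
Hypothesis fact_unit : forall n, (n`!%:R : R) \is a GRing.unit.

Lemma map_mpoly_mderivm n (m : 'X_{1..n}) (A : {mpoly R[n]}) :
  map_mpoly f A^`M[m] = (map_mpoly f A)^`M[m].
Proof.
apply/mpolyP=> m'; rewrite mcoeff_map_mpoly !mcoeff_mderivm raddfMn /=.
by rewrite mcoeff_map_mpoly.
Qed.

(** Since factorials are units, [f] commutes with the normalizing inverse. *)
Lemma map_transvectant m n r A B :
  map_mpoly f (transvectant m n r A B) =
  transvectant m n r (map_mpoly f A) (map_mpoly f B).
Proof.
rewrite /transvectant map_mpolyZ rmorph_sum; congr (_ *: _).
  rewrite rmorphM rmorphV ?unitrM ?fact_unit // !rmorphM !rmorph_nat //.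
apply: eq_bigr => j _ /=; rewrite map_mpolyZ; congr (_ *: _).
  by rewrite rmorphM rmorphXn rmorphN1 rmorph_nat.
by rewrite rmorphM /= !map_mpoly_mderivm.
Qed.

Lemma P_map F G i :
  tnth (P_ (map_mpoly f F) (map_mpoly f G)) i = f (tnth (P_ F G) i).
Proof. exact: (P_morph map_transvectant (mcoeff_map_mpoly f 0%MM)). Qed.

Lemma jD_map G : jD (map_mpoly f G) = f (jD G).
Proof. exact: (jD_morph map_transvectant (mcoeff_map_mpoly f 0%MM)). Qed.

Lemma map_form n (a : 'I_n.+1 -> R) : map_mpoly f (form a) = form (f \o a).
Proof.
rewrite /form rmorph_sum; apply: eq_bigr => i _ /=.
by rewrite map_mpolyZ map_mpolyX.
Qed.

End CoefficientMorphism.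

(** * Homogeneity of the joint invariants *)

Section Homogeneity.
Variables (n : nat) (k : fieldType).
Local Notation S := {mpoly k[n]}.
Implicit Types A B : {mpoly S[2]}.

(** [d] is the degree in the parameters of [S], as opposed to the order in x and y. *)
Definition coef_homog d A : Prop := forall m, A@_m \is d.-homog.

Lemma natr_homog c : (c%:R : S) \is 0.-homog.
Proof. by rewrite -mpolyC_nat -[_%:MP]mulr1 mul_mpolyC dhomogZ ?dhomog1. Qed.

Lemma homog0_inv (c : k) : (c%:MP : S)^-1 \is 0.-homog.
Proof.
have H b : (b%:MP : S) \is 0.-homog.
  by rewrite -[_%:MP]mulr1 mul_mpolyC dhomogZ ?dhomog1.
have [->|c_neq0] := eqVneq c 0; first by rewrite mpolyC0 invr0 dhomog0.
have c_unit : (c%:MP : S) \is a GRing.unit.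
  by apply/unitrP; exists (c^-1)%:MP; rewrite -!mpolyCM mulVf // mulfV.
have -> : (c%:MP : S)^-1 = (c^-1)%:MP; last exact: H.
by apply: (mulrI c_unit); rewrite divrr // -mpolyCM mulfV.
Qed.

Lemma homogM d1 d2 d (p q : S) : p \is d1.-homog -> q \is d2.-homog ->
  (d1 + d2)%N = d -> p * q \is d.-homog.
Proof. by move=> hp hq <-; apply: dhomogM. Qed.

Lemma homogZ0 (d : nat) (c p : S) :
  c \is 0.-homog -> p \is d.-homog -> c * p \is d.-homog.
Proof. exact: (@dhomogM _ _ _ 0). Qed.

Lemma coef_homogM d1 d2 A B : coef_homog d1 A -> coef_homog d2 B ->
  coef_homog (d1 + d2) (A * B).
Proof.
move=> hA hB m; rewrite mcoeffM rpred_sum // => i _.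
by apply: dhomogM.
Qed.

Lemma coef_homogX d e A : coef_homog d A -> coef_homog (d * e) (A ^+ e).
Proof.
move=> hA; elim: e => [|e IH]; last by rewrite exprS mulnS; apply: coef_homogM.
by move=> m; rewrite expr0 muln0 mcoeff1 natr_homog.
Qed.

Lemma coef_homog_transvectant m1 m2 r d1 d2 A B : coef_homog d1 A -> coef_homog d2 B ->
  coef_homog (d1 + d2) (transvectant m1 m2 r A B).
Proof.
move=> hA hB m; rewrite /transvectant mcoeffZ; apply: homogZ0.
  apply: homogZ0; first by rewrite -natrM natr_homog.
  by rewrite -natrM -mpolyC_nat homog0_inv.
rewrite raddf_sum rpred_sum // => j _ /=; rewrite mcoeffZ; apply: homogZ0.
  have hN1 : (-1 : S) \is 0.-homog by rewrite dhomogN dhomog1.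
  apply: homogZ0; last exact: natr_homog.
  by have := dhomogMn j hN1; rewrite mul0n.
apply: coef_homogM => m'; rewrite mcoeff_mderivm; exact: rpredMn.
Qed.

Lemma jinv_homog m d1 d2 A B : coef_homog d1 A -> coef_homog d2 B ->
  jinv m A B \is (d1 + d2).-homog.
Proof. by move=> hA hB; apply: coef_homog_transvectant. Qed.

Lemma binr_homog c : (c%:B : S) \is 0.-homog.
Proof. by rewrite binrE natr_homog. Qed.

Arguments coef_homog_transvectant {m1 m2 r d1 d2 A B}.
Arguments jinv_homog {m d1 d2 A B}.
Arguments coef_homogX {d e A}.

Variables F G : {mpoly S[2]}.
Hypotheses (hF : coef_homog 1 F) (hG : coef_homog 1 G).

Lemma jD_homog : jD G \is 4.-homog.
Proof.
have hh : coef_homog 2 (covh G) := coef_homog_transvectant hG hG.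
exact (jinv_homog hh hh).
Qed.

Let hH : coef_homog 2 (covH F) := coef_homog_transvectant hF hF.
Let hi : coef_homog 2 (covi F) := coef_homog_transvectant hF hF.
Let ht : coef_homog 3 (covt F) := coef_homog_transvectant hF hH.
Let h35 : coef_homog 3 (cov35 F) := coef_homog_transvectant hi hF.
Let h33 : coef_homog 3 (cov33 F) := coef_homog_transvectant hi hF.
Let hh : coef_homog 2 (covh G) := coef_homog_transvectant hG hG.
Let hq : coef_homog 3 (covq G) := coef_homog_transvectant hG hh.

Let hA : jA F G \is 4.-homog := jinv_homog hF (coef_homogM hG hh).
Let hL : jL F G \is 6.-homog := jinv_homog hF (coef_homogM hh hq).
Let hB1 : jB1 F G \is 4.-homog := jinv_homog hi hh.
Let hB2 : jB2 F G \is 4.-homog := jinv_homog hH (coef_homogX (e := 2) hG).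
Let hM : jM F G \is 6.-homog := jinv_homog hH (coef_homogM hG hq).
Let hN : jN F G \is 8.-homog := jinv_homog hH (coef_homogX (e := 2) hq).
Let hR : jR F G \is 4.-homog := jinv_homog h33 hG.
Let hS1 : jS1 F G \is 6.-homog := jinv_homog h33 hq.
Let hS2 : jS2 F G \is 6.-homog := jinv_homog h35 (coef_homogM hG hh).
Let hS3 : jS3 F G \is 6.-homog := jinv_homog ht (coef_homogX (e := 3) hG).
Let hT1 : jT1 F G \is 8.-homog := jinv_homog h35 (coef_homogM hh hq).
Let hT2 : jT2 F G \is 8.-homog :=
  jinv_homog ht (coef_homogM (coef_homogX (e := 2) hG) hq).
Let hT3 : jT3 F G \is 8.-homog :=
  jinv_homog (coef_homogX (e := 3) hF) (coef_homogX (e := 5) hG).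
Let hW : jW F G \is 10.-homog :=
  jinv_homog (coef_homogX (e := 3) hF) (coef_homogM (coef_homogX (e := 4) hG) hq).
Let hD := jD_homog.

Let homogX d1 e d (p : S) : p \is d1.-homog -> (d1 * e)%N = d -> p ^+ e \is d.-homog.
Proof. by move=> hp <-; apply: dhomogMn. Qed.

Let homogD d (p q : S) : p \is d.-homog -> q \is d.-homog -> p + q \is d.-homog.
Proof. exact: rpredD. Qed.

Let homogN d (p : S) : p \is d.-homog -> - p \is d.-homog.
Proof. by rewrite dhomogN. Qed.

Ltac solve_homog := lazymatch goal with
  | |- is_true (binr _ \in _) => exact: binr_homog
  | |- is_true (jD _ \in _) => exact: hD
  | |- is_true (jA _ _ \in _) => exact: hA
  | |- is_true (jL _ _ \in _) => exact: hL
  | |- is_true (jB1 _ _ \in _) => exact: hB1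
  | |- is_true (jB2 _ _ \in _) => exact: hB2
  | |- is_true (jM _ _ \in _) => exact: hM
  | |- is_true (jN _ _ \in _) => exact: hN
  | |- is_true (jR _ _ \in _) => exact: hR
  | |- is_true (jS1 _ _ \in _) => exact: hS1
  | |- is_true (jS2 _ _ \in _) => exact: hS2
  | |- is_true (jS3 _ _ \in _) => exact: hS3
  | |- is_true (jT1 _ _ \in _) => exact: hT1
  | |- is_true (jT2 _ _ \in _) => exact: hT2
  | |- is_true (jT3 _ _ \in _) => exact: hT3
  | |- is_true (jW _ _ \in _) => exact: hW
  | |- is_true (_ + _ \in _) => apply: homogD; solve_homog
  | |- is_true (- _ \in _) => apply: homogN; solve_homog
  | |- is_true (_ ^+ _ \in _) => eapply homogX; [solve_homog | reflexivity]
  | |- is_true (_ * _ \in _) =>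
      eapply homogM; [solve_homog | solve_homog | reflexivity]
  end.

(** This is the degree of the power of [jD] in the denominator of [U i]. *)
Lemma P_homog i : tnth (P_ F G) i \is (4 * tnth m_ i).-homog.
Proof.
case: i => [[|[|[|[|[|[|i]]]]]] //= lt_i6]; rewrite !(tnth_nth 0) /=.
- by rewrite /P1; solve_homog.
- by rewrite /P2; solve_homog.
- by rewrite /P3; solve_homog.
- by rewrite /P4; solve_homog.
- by rewrite /P5; solve_homog.
- by rewrite /P6; solve_homog.
Qed.

End Homogeneity.

(** * Polynomial functions over a field of characteristic zero *)

Section PolynomialFunctions.
Variable k : fieldType.
Hypothesis char0 : [pchar k] =i pred0.

Let natr_eq0 n : (n%:R == 0 :> k) = (n == 0%N).
Proof. by have /pcharf0P := char0. Qed.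

Lemma natr_neq0 n : n.+1%:R != 0 :> k.
Proof. by rewrite natr_eq0. Qed.

Lemma natr_inj : injective (fun n => n%:R : k).
Proof.
have le_inj m n : (m <= n)%N -> m%:R = n%:R :> k -> m = n.
  move=> le_mn /eqP; rewrite eq_sym -subr_eq0 -natrB // natr_eq0.
  by rewrite subn_eq0 => le_nm; apply/eqP; rewrite eqn_leq le_mn.
move=> m n eq_mn; case/orP: (leq_total m n) => le_mn; first exact: le_inj.
by apply/esym/le_inj.
Qed.

(** In characteristic zero the integers below [size q] are distinct, which is one root too many. *)
Lemma poly_fun_eq0 (q : {poly k}) : (forall x, q.[x] = 0) -> q = 0.
Proof.
move=> q0; apply/eqP; apply: contraT => q_neq0.
have := max_poly_roots (rs := [seq i%:R | i <- iota 0 (size q)]) q_neq0.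
rewrite size_map size_iota ltnn; apply.
  by apply/allP => x _; apply/rootP/q0.
by rewrite map_inj_uniq ?iota_uniq //; apply: natr_inj.
Qed.

Local Notation widen := (widen_ord (leqnSn _)).

(** [muni] makes [p] univariate in the last variable. For fixed values of the others it vanishes
    identically, so each of its coefficients is a vanishing function of these values and the
    induction hypothesis applies. *)
Lemma mpoly_fun_eq0 n (p : {mpoly k[n]}) : (forall v, p.@[v] = 0) -> p = 0.
Proof.
elim: n p => [|n IH] p p0.
  by have := p0 (fun=> 0); rewrite [p]nvar0_mpolyC mevalC => ->.
have muni_coef (m : 'X_{1..n.+1}) :
      (muni p)`_(m ord_max)@_[multinom m (widen i) | i < n] = p@_m.
  rewrite muniE coef_sum raddf_sum /=.
  have E (m' : 'X_{1..n.+1}) :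
      ((p@_m' *: 'X_[[multinom m' (widen i) | i < n]] *: 'X^(m' ord_max))`_
      (m ord_max))@_[multinom m (widen i) | i < n] = p@_m' *+ (m' == m).
    rewrite coefZ coefXn -scalerAl mcoeffZ mulr_natr mcoeffMn mcoeffX.
    rewrite -mulrnA mulnb mulr_natr; congr (_ *+ nat_of_bool _).
    apply/andP/eqP => [[/eqP /mnmP Em /eqP Emax]|->]; last by rewrite !eqxx.
    apply/mnmP=> i; have [lt_in|le_ni] := ltnP i n.
      have := Em (Ordinal lt_in); rewrite !mnmE.
      by have -> : widen (Ordinal lt_in) = i by apply: val_inj.
    have -> // : i = ord_max.
    by apply: val_inj; apply/eqP; rewrite eqn_leq le_ni -ltnS ltn_ord.
  under eq_bigr do rewrite E.
  have [m_p|m_p] := boolP (m \in msupp p).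
    rewrite (bigD1_seq m) ?msupp_uniq //= eqxx mulr1n big1 ?addr0 // => m'.
    by move/negbTE ->.
  rewrite memN_msupp_eq0 // big_seq big1 // => m' m'_p.
  by case: eqP => // eq_m; rewrite -eq_m m'_p in m_p.
apply/mpolyP=> m; rewrite -muni_coef mcoeff0.
suff -> : (muni p)`_(m ord_max) = 0 by rewrite mcoeff0.
apply: IH => v; rewrite -(coef_map (meval v)).
suff -> : map_poly (meval v) (muni p) = 0 by rewrite coef0.
apply: poly_fun_eq0 => x.
pose w (i : 'I_n.+1) := if unlift ord_max i is Some j then v j else x.
rewrite -[RHS](p0 w) mevalE muniE rmorph_sum horner_sum; apply: eq_bigr => m' _.
rewrite big_ord_recr /= map_polyZ map_polyXn hornerZ hornerXn /= mevalZ mevalX mulrA.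
have -> : w ord_max = x by rewrite /w unlift_none.
congr (_ * _ * _); apply: eq_bigr => i _; rewrite mnmE; congr (_ ^+ m' _).
have <- : lift ord_max i = widen i by apply: val_inj; exact: lift_max.
by rewrite /w liftK.
Qed.

Lemma mpoly_fun_eq n (p q : {mpoly k[n]}) : (forall v, p.@[v] = q.@[v]) -> p = q.
Proof.
by move=> eq_pq; apply/subr0_eq/mpoly_fun_eq0 => v; rewrite mevalB eq_pq subrr.
Qed.

End PolynomialFunctions.

Lemma meval_homog n (R : comNzRingType) d (p : {mpoly R[n]}) c v :
  p \is d.-homog -> p.@[fun i => c * v i] = c ^+ d * p.@[v].
Proof.
move=> /dhomogP hp; rewrite !mevalE mulr_sumr; apply: eq_big_seq => m m_p.
rewrite mulrCA; congr (_ * _).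
have <- : mdeg m = d := hp m m_p.
rewrite mdegE -prodrXr -big_split /=.
by apply: eq_bigr => i _; rewrite exprMn.
Qed.

(** * The joint invariants on the slice *)

Section Slice.
Variable k : fieldType.
Hypothesis natr_neq0 : forall n, n.+1%:R != 0 :> k.

Lemma fact_unit n : (n`!%:R : k) \is a GRing.unit.
Proof. by rewrite unitfE -(prednK (fact_gt0 n)) natr_neq0. Qed.

(** Cancelling factorials leaves falling factorials, so that [field] meets only small numerals. *)
Lemma transvectant_dform_ffact m n r (s t : seq k) : (r <= m)%N -> (r <= n)%N ->
    (r < size s)%N -> (r < size t)%N ->
  transvectant m n r (dform s) (dform t) =
  dform (scalel ((m ^_ r)%:R * (n ^_ r)%:R)^-1 (transl r s t)).
Proof.
move=> le_rm le_rn ls lt; rewrite transvectant_dform // dform_scale; congr (_ *: _).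
rewrite -(ffact_fact le_rm) -(ffact_fact le_rn) !natrM.
have [U V] := (fact_unit (m - r), fact_unit (n - r)).
rewrite mulrACA invfM mulrCA mulfV ?mulr1 //.
by rewrite mulf_neq0 -?unitfE.
Qed.

(** A [foldr] over [iota] unfolds by computation, unlike the big sum of [jinvE]. *)
Lemma jinv_dform n (s t : seq k) : size s = n.+1 -> size t = n.+1 ->
  jinv n (dform s) (dform t) =
  foldr +%R 0 [seq (-1) ^+ j * (s`_j * t`_(n - j)) / 'C(n, j)%:R | j <- iota 0 n.+1].
Proof.
move=> sz_s sz_t; rewrite foldrE big_map -[iota _ _]/(index_iota 0 n.+1) big_mkord.
rewrite jinvE ?fact_unit //; apply: eq_bigr => j _.
have n_s : n = (size s).-1 by rewrite sz_s.
have n_t : n = (size t).-1 by rewrite sz_t.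
by rewrite {2}n_s dform_coef ?sz_s // {3}n_t dform_coef // sz_t ltnS leq_subr.
Qed.

Variables a b c d e f : k.
Let F := dform [:: a; b; c; d; e; f].
Let G : {mpoly k[2]} := dform [:: 1; 0; 0; 1].

Ltac coefs := apply: (congr1 (@dform k));
  repeat match goal with |- _ :: _ = _ :: _ => apply: (f_equal2 cons) end;
  [.. | reflexivity].
Ltac nonzero := do ?[apply/andP; split]; first [exact: oner_neq0 | exact: natr_neq0].
Ltac eval_nat :=
  repeat match goal with
  | |- context [falling_factorial ?n ?m] =>
      let v := eval vm_compute in (falling_factorial n m) in
      change (falling_factorial n m) with v
  | |- context [binomial ?n ?m] =>
      let v := eval vm_compute in (binomial n m) in change (binomial n m) with v
  end.
Ltac eval_lists := cbv beta iota zeta delta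
  [transl mull addl scalel dxl dyl dyl_from iter iota foldr map nseq ncons cat
   size behead nth predn addn subn Nat.add Nat.sub Nat.pred].
Ltac transv := (rewrite transvectant_dform_ffact; [|by []|by []|by []|by []]); eval_lists;
  coefs; eval_nat; field; nonzero.
Ltac prodl := eval_lists; coefs; ring.
Ltac pairing := (rewrite jinv_dform; [|by []|by []]); eval_lists; eval_nat;
  field; nonzero.

Let F3_slice : F ^+ 3 = dform (mull [:: a; b; c; d; e; f]
  (mull [:: a; b; c; d; e; f] [:: a; b; c; d; e; f])).
Proof. by rewrite !dform_mul. Qed.


Lemma covH_slice : covH F =
  dform [:: (5 * a * c - 2 * b ^+ 2) / 25;
   (15 * a * d - 3 * b * c) / 25;
   (30 * a * e + 3 * b * d - 3 * c ^+ 2) / 25;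
   (50 * a * f + 14 * b * e - 4 * c * d) / 25;
   (30 * b * f + 3 * c * e - 3 * d ^+ 2) / 25;
   (15 * c * f - 3 * d * e) / 25;
   (5 * d * f - 2 * e ^+ 2) / 25].
Proof. rewrite /covH; transv. Qed.

Lemma covi_slice : covi F =
  dform [:: (20 * a * e - 8 * b * d + 3 * c ^+ 2) / 50;
   (50 * a * f - 6 * b * e + c * d) / 25;
   (20 * b * f - 8 * c * e + 3 * d ^+ 2) / 50].
Proof. rewrite /covi; transv. Qed.

Lemma cov35_slice : cov35 F =
  dform [:: (- 250 * a ^+ 2 * f + 50 * a * b * e - 5 * a * c * d - 8 * b ^+ 2 * d + 3 *
     b * c ^+ 2) / 250;
   (- 250 * a * b * f + 80 * a * c * e - 15 * a * d ^+ 2 + 18 * b ^+ 2 * e -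
     19 * b * c * d + 6 * c ^+ 3) / 250;
   (- 25 * a * c * f + 30 * a * d * e - 40 * b ^+ 2 * f + 19 * b * c * e - 18
     * b * d ^+ 2 + 4 * c ^+ 2 * d) / 125;
   (25 * a * d * f + 40 * a * e ^+ 2 - 30 * b * c * f - 19 * b * d * e + 18 *
     c ^+ 2 * e - 4 * c * d ^+ 2) / 125;
   (250 * a * e * f - 80 * b * d * f - 18 * b * e ^+ 2 + 15 * c ^+ 2 * f + 19
     * c * d * e - 6 * d ^+ 3) / 250;
   (250 * a * f ^+ 2 - 50 * b * e * f + 5 * c * d * f + 8 * c * e ^+ 2 - 3 * d
     ^+ 2 * e) / 250].
Proof. rewrite /cov35 covi_slice; transv. Qed.

Lemma cov33_slice : cov33 F =
  dform [:: (- 60 * a * c * e + 30 * a * d ^+ 2 + 24 * b ^+ 2 * e - 12 * b * c * d + 3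
     * c ^+ 3) / 500;
   (- 300 * a * c * f + 60 * a * d * e + 120 * b ^+ 2 * f - 12 * b * c * e - 6
     * b * d ^+ 2 + 3 * c ^+ 2 * d) / 500;
   (- 300 * a * d * f + 120 * a * e ^+ 2 + 60 * b * c * f - 12 * b * d * e - 6
     * c ^+ 2 * e + 3 * c * d ^+ 2) / 500;
   (- 60 * b * d * f + 24 * b * e ^+ 2 + 30 * c ^+ 2 * f - 12 * c * d * e + 3
     * d ^+ 3) / 500].
Proof. rewrite /cov33 covi_slice; transv. Qed.

Lemma covt_slice : covt F =
  dform [:: (25 * a ^+ 2 * d - 15 * a * b * c + 4 * b ^+ 3) / 250;
   (100 * a ^+ 2 * e + 5 * a * b * d - 30 * a * c ^+ 2 + 9 * b ^+ 2 * c) / 250;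
   (250 * a ^+ 2 * f + 110 * a * b * e - 85 * a * c * d + 16 * b ^+ 2 * d + 3
     * b * c ^+ 2) / 250;
   (350 * a * b * f - 40 * a * c * e - 85 * a * d ^+ 2 + 58 * b ^+ 2 * e - b *
     c * d + 2 * c ^+ 3) / 250;
   (125 * a * c * f - 200 * a * d * e + 160 * b ^+ 2 * f + 47 * b * c * e - 22
     * b * d ^+ 2 + 4 * c ^+ 2 * d) / 250;
   (- 125 * a * d * f - 160 * a * e ^+ 2 + 200 * b * c * f - 47 * b * d * e +
     22 * c ^+ 2 * e - 4 * c * d ^+ 2) / 250;
   (- 350 * a * e * f + 40 * b * d * f - 58 * b * e ^+ 2 + 85 * c ^+ 2 * f + c
     * d * e - 2 * d ^+ 3) / 250;
   (- 250 * a * f ^+ 2 - 110 * b * e * f + 85 * c * d * f - 16 * c * e ^+ 2 -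
     3 * d ^+ 2 * e) / 250;
   (- 100 * b * f ^+ 2 - 5 * c * e * f + 30 * d ^+ 2 * f - 9 * d * e ^+ 2) /
     250;
   (- 25 * c * f ^+ 2 + 15 * d * e * f - 4 * e ^+ 3) / 250].
Proof. rewrite /covt covH_slice; transv. Qed.

Lemma covh_slice : covh G =
  dform [:: 0;
   2;
   0].
Proof. rewrite /covh; transv. Qed.

Lemma covq_slice : covq G =
  dform [:: 1;
   0;
   0;
   - 1].
Proof. rewrite /covq covh_slice; transv. Qed.

Let Gh_slice : G * covh G =
  dform [:: 0; 2; 0; 0; 2; 0].
Proof. rewrite  covh_slice -dform_mul; [prodl | by []]. Qed.

Let hq_slice : covh G * covq G =
  dform [:: 0; 2; 0; 0; - 2; 0].
Proof. rewrite  covh_slice covq_slice -dform_mul; [prodl | by []]. Qed.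

Let GG_slice : G ^+ 2 =
  dform [:: 1; 0; 0; 2; 0; 0; 1].
Proof. rewrite expr2  -dform_mul; [prodl | by []]. Qed.

Let Gq_slice : G * covq G =
  dform [:: 1; 0; 0; 0; 0; 0; - 1].
Proof. rewrite  covq_slice -dform_mul; [prodl | by []]. Qed.

Let qq_slice : covq G ^+ 2 =
  dform [:: 1; 0; 0; - 2; 0; 0; 1].
Proof. rewrite expr2 covq_slice -dform_mul; [prodl | by []]. Qed.

Let G3_slice : G ^+ 3 =
  dform [:: 1; 0; 0; 3; 0; 0; 3; 0; 0; 1].
Proof. rewrite exprSr GG_slice  -dform_mul; [prodl | by []]. Qed.

Let G2q_slice : G ^+ 2 * covq G =
  dform [:: 1; 0; 0; 1; 0; 0; - 1; 0; 0; - 1].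
Proof. rewrite GG_slice covq_slice -dform_mul; [prodl | by []]. Qed.

Let G4_slice : G ^+ 4 =
  dform [:: 1; 0; 0; 4; 0; 0; 6; 0; 0; 4; 0; 0; 1].
Proof. rewrite (exprM _ 2 2) GG_slice expr2  -dform_mul; [prodl | by []]. Qed.

Let G5_slice : G ^+ 5 =
  dform [:: 1; 0; 0; 5; 0; 0; 10; 0; 0; 10; 0; 0; 5; 0; 0; 1].
Proof. rewrite exprSr G4_slice  -dform_mul; [prodl | by []]. Qed.

Let G4q_slice : G ^+ 4 * covq G =
  dform [:: 1; 0; 0; 3; 0; 0; 2; 0; 0; - 2; 0; 0; - 3; 0; 0; - 1].
Proof. rewrite G4_slice covq_slice -dform_mul; [prodl | by []]. Qed.

Lemma jD_slice : jD G =
    - 2.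
Proof. rewrite /jD covh_slice; pairing. Qed.

Lemma jA_slice : jA F G =
    (- 2 * b + 2 * e) / 5.
Proof. rewrite /jA Gh_slice; pairing. Qed.

Lemma jL_slice : jL F G =
    (2 * b + 2 * e) / 5.
Proof. rewrite /jL hq_slice; pairing. Qed.

Lemma jB1_slice : jB1 F G =
    (- 50 * a * f + 6 * b * e - c * d) / 25.
Proof. rewrite /jB1 covi_slice covh_slice; pairing. Qed.

Lemma jB2_slice : jB2 F G =
    (25 * a * c - 25 * a * f - 10 * b ^+ 2 - 7 * b * e + 2 * c * d + 25 *
    d * f - 10 * e ^+ 2) / 125.
Proof. rewrite /jB2 covH_slice GG_slice; pairing. Qed.

Lemma jM_slice : jM F G =
    (- 5 * a * c + 2 * b ^+ 2 + 5 * d * f - 2 * e ^+ 2) / 25.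
Proof. rewrite /jM covH_slice Gq_slice; pairing. Qed.

Lemma jN_slice : jN F G =
    (25 * a * c + 25 * a * f - 10 * b ^+ 2 + 7 * b * e - 2 * c * d + 25 *
    d * f - 10 * e ^+ 2) / 125.
Proof. rewrite /jN covH_slice qq_slice; pairing. Qed.

Lemma jR_slice : jR F G =
    (- 60 * a * c * e + 30 * a * d ^+ 2 + 24 * b ^+ 2 * e - 12 * b * c * d
    + 60 * b * d * f - 24 * b * e ^+ 2 + 3 * c ^+ 3 - 30 * c ^+ 2 * f + 12
    * c * d * e - 3 * d ^+ 3) / 500.
Proof. rewrite /jR cov33_slice; pairing. Qed.

Lemma jS1_slice : jS1 F G =
    (60 * a * c * e - 30 * a * d ^+ 2 - 24 * b ^+ 2 * e + 12 * b * c * d +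
    60 * b * d * f - 24 * b * e ^+ 2 - 3 * c ^+ 3 - 30 * c ^+ 2 * f + 12 *
    c * d * e - 3 * d ^+ 3) / 500.
Proof. rewrite /jS1 cov33_slice covq_slice; pairing. Qed.

Lemma jS2_slice : jS2 F G =
    (250 * a * b * f - 80 * a * c * e + 15 * a * d ^+ 2 + 250 * a * e * f
    - 18 * b ^+ 2 * e + 19 * b * c * d - 80 * b * d * f - 18 * b * e ^+ 2
    - 6 * c ^+ 3 + 15 * c ^+ 2 * f + 19 * c * d * e - 6 * d ^+ 3) / 625.
Proof. rewrite /jS2 cov35_slice Gh_slice; pairing. Qed.

Lemma jS3_slice : jS3 F G =
    (700 * a ^+ 2 * d - 420 * a * b * c - 350 * a * b * f + 40 * a * c * e
    + 85 * a * d ^+ 2 - 350 * a * e * f + 112 * b ^+ 3 - 58 * b ^+ 2 * e +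
    b * c * d + 40 * b * d * f - 58 * b * e ^+ 2 - 2 * c ^+ 3 + 85 * c ^+
    2 * f + c * d * e + 700 * c * f ^+ 2 - 2 * d ^+ 3 - 420 * d * e * f +
    112 * e ^+ 3) / 7000.
Proof. rewrite /jS3 covt_slice G3_slice; pairing. Qed.

Lemma jT1_slice : jT1 F G =
    (- 250 * a * b * f + 80 * a * c * e - 15 * a * d ^+ 2 + 250 * a * e *
    f + 18 * b ^+ 2 * e - 19 * b * c * d - 80 * b * d * f - 18 * b * e ^+
    2 + 6 * c ^+ 3 + 15 * c ^+ 2 * f + 19 * c * d * e - 6 * d ^+ 3) / 625.
Proof. rewrite /jT1 cov35_slice hq_slice; pairing. Qed.

Lemma jT2_slice : jT2 F G =
    (- 2100 * a ^+ 2 * d + 1260 * a * b * c + 350 * a * b * f - 40 * a * c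
    * e - 85 * a * d ^+ 2 - 350 * a * e * f - 336 * b ^+ 3 + 58 * b ^+ 2 *
    e - b * c * d + 40 * b * d * f - 58 * b * e ^+ 2 + 2 * c ^+ 3 + 85 * c
    ^+ 2 * f + c * d * e + 2100 * c * f ^+ 2 - 2 * d ^+ 3 - 1260 * d * e *
    f + 336 * e ^+ 3) / 21000.
Proof. rewrite /jT2 covt_slice G2q_slice; pairing. Qed.

Lemma jT3_slice : jT3 F G =
    (1001 * a ^+ 3 - 33 * a ^+ 2 * d - 66 * a * b * c + 12 * a * b * f +
    12 * a * c * e + 6 * a * d ^+ 2 - 12 * a * e * f - 11 * b ^+ 3 + 6 * b
    ^+ 2 * e + 12 * b * c * d - 12 * b * d * f - 6 * b * e ^+ 2 + 2 * c ^+
    3 - 6 * c ^+ 2 * f - 12 * c * d * e + 33 * c * f ^+ 2 - 2 * d ^+ 3 +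
    66 * d * e * f + 11 * e ^+ 3 - 1001 * f ^+ 3) / 1001.
Proof. rewrite /jT3 F3_slice G5_slice; pairing. Qed.

Lemma jW_slice : jW F G =
    (- 5005 * a ^+ 3 + 99 * a ^+ 2 * d + 198 * a * b * c - 12 * a * b * f
    - 12 * a * c * e - 6 * a * d ^+ 2 - 12 * a * e * f + 33 * b ^+ 3 - 6 *
    b ^+ 2 * e - 12 * b * c * d - 12 * b * d * f - 6 * b * e ^+ 2 - 2 * c
    ^+ 3 - 6 * c ^+ 2 * f - 12 * c * d * e + 99 * c * f ^+ 2 - 2 * d ^+ 3
    + 198 * d * e * f + 33 * e ^+ 3 - 5005 * f ^+ 3) / 5005.
Proof. rewrite /jW F3_slice G4q_slice; pairing. Qed.

End Slice.

(** * The numerators in the coordinates adapted to S_3 *)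

Section NormalizedInvariants.
Variable k : fieldType.
Hypothesis natr_neq0 : forall n, n.+1%:R != 0 :> k.
Variables s p u w v z : k.

Let F := dform [:: 49 * v; p + s; 5 * z - w; u - 5 * v; p - s; - 49 * z].
Let G : {mpoly k[2]} := dform [:: 1; 0; 0; 1].

Ltac nonzero := do ?[apply/andP; split]; first [exact: oner_neq0 | exact: natr_neq0].
Ltac normalize := rewrite ?(jD_slice natr_neq0, jA_slice natr_neq0,
  jL_slice natr_neq0, jB1_slice natr_neq0, jB2_slice natr_neq0,
  jM_slice natr_neq0, jN_slice natr_neq0, jR_slice natr_neq0,
  jS1_slice natr_neq0, jS2_slice natr_neq0, jS3_slice natr_neq0,
  jT1_slice natr_neq0, jT2_slice natr_neq0, jT3_slice natr_neq0,
  jW_slice natr_neq0); rewrite /binr; unfold posr; field; nonzero.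

(** Here and below the three factors are c_i, the value -2 of [jD] to the power m_i, and the value
    of U_i on the slice. *)
Lemma P1_slice : P1 F G = 3%:B * (- 2) ^+ 1 * (280 / 3 * s).
Proof. rewrite /P1; normalize. Qed.

Lemma P2_slice : P2 F G = 54%:B * (- 2) ^+ 3 * (120050%:B / 27 * (u * w)).
Proof. rewrite /P2; normalize. Qed.

Lemma P3_slice : P3 F G = 20432412%:B * (- 2) ^+ 4 *
  ((245 / 9) ^+ 3 * (u ^+ 3 + w ^+ 3)).
Proof. rewrite /P3; normalize. Qed.

Lemma P4_slice : P4 F G = 18%:B * (- 2) ^+ 3 *
  (- (24010%:B / 9 * (u * w)) - 192080%:B * (u * z + v * w)).
Proof. rewrite /P4; normalize. Qed.

Lemma P5_slice : P5 F G = 2270268%:B * (- 2) ^+ 4 *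
  (- (2941225%:B / 81 * (u ^+ 3 + w ^+ 3))
   - 47059600%:B / 9 * (u ^+ 2 * v + w ^+ 2 * z)).
Proof. rewrite /P5; normalize. Qed.

Lemma P6_slice : P6 F G = 27027%:B * (- 2) ^+ 6 *
  (- (411771500%:B / 27 * (p * (u ^+ 3 - w ^+ 3)))).
Proof. rewrite /P6; normalize. Qed.

End NormalizedInvariants.

(** * Pairs of forms and the normal form of a binary cubic *)

Section BinaryForms.
Variable R : comUnitRingType.

Lemma mdeg_mon n i : (i <= n)%N -> mdeg (mon n i) = n.
Proof. by move=> le_in; rewrite /mon mdegD !mdegMn !mdeg1 !mul1n subnK. Qed.

Lemma mon_mdeg (m : 'X_{1..2}) : mon (mdeg m) (m ord_max) = m.
Proof.
have -> : mdeg m = (m ord0 + m ord_max)%N.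
  rewrite mdegE big_ord_recl big_ord1; congr (_ + m _)%N; exact: val_inj.
apply/mnmP=> i; rewrite mnmDE !mulmnE !mnm1E addnK.
by case: i => [[|[|]]] //= lt_i2; rewrite ?mul0n ?mul1n ?addn0 ?add0n; congr (m _);
  apply: val_inj.
Qed.

Lemma mon_inj n (i j : 'I_n.+1) : mon n i = mon n j -> i = j.
Proof.
move/mnmP/(_ ord_max); rewrite !mnmDE !mulmnE !mnm1E /= !mul0n !mul1n !add0n.
exact: val_inj.
Qed.

Lemma form_coef n (a : 'I_n.+1 -> R) (j : 'I_n.+1) : (form a)@_(mon n j) = a j.
Proof.
rewrite /form raddf_sum /= (bigD1 j) //= mcoeffZ mcoeffX eqxx mulr1.
rewrite big1 ?addr0 // => i ne_ij.
rewrite mcoeffZ mcoeffX; case: eqP => [/mon_inj eq_ij|_]; last by rewrite mulr0.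
by rewrite eq_ij eqxx in ne_ij.
Qed.

Lemma form_homog n (a : 'I_n.+1 -> R) : form a \is n.-homog.
Proof.
apply: rpred_sum => i _; apply: dhomogZ.
by rewrite dhomogX; apply/eqP/mdeg_mon; rewrite -ltnS.
Qed.

Lemma homog_form n (A : {mpoly R[2]}) : A \is n.-homog ->
  A = form (fun i : 'I_n.+1 => A@_(mon n i)).
Proof.
move=> hA; apply/mpolyP=> m; have [deg_m|deg_m] := eqVneq (mdeg m) n; last first.
  by rewrite (dhomog_nemf_coeff hA) // (dhomog_nemf_coeff (form_homog _)).
have lt_m : (m ord_max < n.+1)%N.
  by rewrite ltnS -deg_m mdegE (bigD1 ord_max) //= leq_addr.
by rewrite -(mon_mdeg m) deg_m (form_coef _ (Ordinal lt_m)).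
Qed.

Lemma eq_form n (a b : 'I_n.+1 -> R) : a =1 b -> form a = form b.
Proof. by move=> eq_ab; apply: eq_bigr => i _; rewrite eq_ab. Qed.

Lemma formZ n c (a : 'I_n.+1 -> R) : form (fun i => c * a i) = c *: form a.
Proof. by rewrite /form scaler_sumr; apply: eq_bigr => i _; rewrite scalerA. Qed.

Lemma quinticZ c (v : 'I_(6 + 4) -> R) : quintic (fun i => c * v i) = c *: quintic v.
Proof. exact: formZ. Qed.

Lemma cubicZ c (v : 'I_(6 + 4) -> R) : cubic (fun i => c * v i) = c *: cubic v.
Proof. exact: formZ. Qed.

Lemma substf_homog n (g : 'M[R]_2) A : A \is n.-homog -> substf g A \is n.-homog.
Proof.
move=> /dhomogP hA; rewrite /substf comp_mpolyEX big_seq; apply: rpred_sum => m m_A.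
apply: dhomogZ; rewrite comp_mpolyX; have <- : mdeg m = n := hA m m_A.
rewrite mdegE; apply: (big_ind2 (fun (p : {mpoly R[2]}) d => p \is d.-homog)).
- exact: dhomog1.
- by move=> p d q e hp hq; apply: dhomogM.
move=> i _; rewrite tnth_mktuple -[X in X.-homog]mul1n; apply: dhomogMn.
by apply: rpred_sum => j _; apply: dhomogZ; rewrite dhomogX; apply/eqP/mdeg1.
Qed.

(** [subst_pair] records only the coefficients in order 5; nothing is lost because substitution
    preserves the order. *)
Lemma quintic_subst g (v : 'I_(6 + 4) -> R) :
  quintic (subst_pair g v) = substf g (quintic v).
Proof.
rewrite [RHS](@homog_form 5) ?substf_homog ?form_homog //; apply: eq_form => i.
by rewrite /subst_pair (unsplitK (inl i)).
Qed.

Lemma cubic_subst g (v : 'I_(6 + 4) -> R) :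
  cubic (subst_pair g v) = substf g (cubic v).
Proof.
rewrite [RHS](@homog_form 3) ?substf_homog ?form_homog //; apply: eq_form => i.
by rewrite /subst_pair (unsplitK (inr i)).
Qed.

Lemma eq_pair (v w : 'I_(6 + 4) -> R) :
  quintic v = quintic w -> cubic v = cubic w -> v =1 w.
Proof.
move=> eqF eqG i; rewrite -(splitK i); case: (split i) => j /=.
  by have := congr1 (mcoeff (mon 5 j)) eqF; rewrite !form_coef.
by have := congr1 (mcoeff (mon 3 j)) eqG; rewrite !form_coef.
Qed.

Lemma quintic_cat (s r : seq R) : size s = 6 ->
  quintic (fun i => (s ++ r)`_i) = dform s.
Proof.
move=> sz; rewrite -(@form_nth _ 5) //; apply: eq_form => i.
by rewrite nth_cat sz /= ltn_ord.
Qed.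

Lemma cubic_cat (s r : seq R) : size s = 6 -> size r = 4 ->
  cubic (fun i => (s ++ r)`_i) = dform r.
Proof.
move=> sz sz'; rewrite -(@form_nth _ 3) //; apply: eq_form => i.
by rewrite nth_cat sz /= addKn.
Qed.

End BinaryForms.

(** * Reduction of a pair to the slice *)

Section NormalForm.
Variable k : closedFieldType.
Hypothesis char0 : [pchar k] =i pred0.

Lemma closed_sqrt (a : k) : exists x, x ^+ 2 = a.
Proof.
have [x] := @solve_monicpoly k 2 (fun i => if i is 0 then a else 0) isT.
rewrite !big_ord_recl big_ord0 /= expr0 mulr1 mul0r !addr0 => Ex; by exists x.
Qed.

Lemma closed_cbrt (a : k) : exists x, x ^+ 3 = a.
Proof.
have [x] := @solve_monicpoly k 3 (fun i => if i is 0 then a else 0) isT.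
rewrite !big_ord_recl big_ord0 /= expr0 mulr1 !mul0r !addr0 => Ex; by exists x.
Qed.

Lemma closed_quadratic (a b : k) : exists x, x ^+ 2 = a * x + b.
Proof.
have [x] := @solve_monicpoly k 2 (fun i => if i is 0 then b else a) isT.
rewrite !big_ord_recl big_ord0 /= expr0 mulr1 addr0 expr1 addrC => Ex; by exists x.
Qed.

Lemma cube_root_of_unity : exists w : k, w ^+ 2 + w + 1 = 0.
Proof.
have [w Ew] := closed_quadratic (-1) (-1); exists w; rewrite Ew; ring.
Qed.

Lemma cubic_factor (b0 b1 b2 b3 : k) : b0 != 0 ->
  exists x1 x2 x3, [/\ b1 = - b0 * (x1 + x2 + x3),
    b2 = b0 * (x1 * x2 + x2 * x3 + x3 * x1) & b3 = - b0 * (x1 * x2 * x3)].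
Proof.
move=> b0_neq0; pose q : {poly k} := Poly [:: b3; b2; b1; b0].
have [r Er] := closed_field_poly_normal q.
have qE : q = [:: b3; b2; b1; b0] :> seq k by apply: (@PolyK _ 0).
have lcE : lead_coef q = b0 by rewrite lead_coefE qE.
rewrite lcE in Er.
have sz : size r = 3%N.
  have : size q = 4%N by rewrite qE.
  by rewrite Er size_scale // size_prod_XsubC => -[].
case: r sz Er => [|x1 [|x2 [|x3 []]]] //= _.
rewrite !big_cons big_nil mulr1 => Er; exists x1, x2, x3.
have E : q = b0 *: ('X^3 - (x1 + x2 + x3)%:P * 'X^2 +
   (x1 * x2 + x2 * x3 + x3 * x1)%:P * 'X - (x1 * x2 * x3)%:P).
  rewrite Er; congr (_ *: _); rewrite !rmorphD !rmorphM /=; ring.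
have C i : q`_i = [:: b3; b2; b1; b0]`_i by rewrite qE.
have {}E i := congr1 (fun p : {poly k} => p`_i) E.
split.
- have := C 2%N; rewrite E !coefE /= => <-; ring.
- have := C 1%N; rewrite E !coefE /= => <-; ring.
have := C 0%N; rewrite E !coefE /= => <-; ring.
Qed.

(* [u] and [w] are, up to constants, the linear forms in the coefficients of [F] whose
   product and sum of cubes are [U_2] and [U_3] on the slice. *)
Definition slice_quintic (s p u w v z : k) : seq k :=
  [:: 49 * v; p + s; 5 * z - w; u - 5 * v; p - s; - 49 * z].

Definition slice_cubic : seq k := [:: 1; 0; 0; 1].

Definition slice s p u w v z : 'I_(6 + 4) -> k :=
  fun i => (slice_quintic s p u w v z ++ slice_cubic)`_i.

Lemma quintic_slice s p u w v z :
  quintic (slice s p u w v z) = dform (slice_quintic s p u w v z).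
Proof. exact: quintic_cat. Qed.

Lemma cubic_slice s p u w v z : cubic (slice s p u w v z) = dform slice_cubic.
Proof. exact: cubic_cat. Qed.

Lemma slice_quintic_onto (a : 'I_6 -> k) : exists s p u w v z,
  form a = dform (slice_quintic s p u w v z).
Proof.
have two0 : (2 : k) != 0 := natr_neq0 char0 1.
have n49 : (49 : k) != 0 := natr_neq0 char0 48.
pose c i := a (inord i).
exists ((c 1 - c 4) / 2), ((c 1 + c 4) / 2), (c 3 + 5 * (c 0 / 49)),
  (5 * (- c 5 / 49) - c 2), (c 0 / 49), (- c 5 / 49).
have <- : [:: c 0; c 1; c 2; c 3; c 4; c 5] = slice_quintic ((c 1 - c 4) / 2)
  ((c 1 + c 4) / 2) (c 3 + 5 * (c 0 / 49)) (5 * (- c 5 / 49) - c 2) (c 0 / 49) (- c 5 / 49).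
  by rewrite /slice_quintic; congr [:: _; _; _; _; _; _]; field.
rewrite -(@form_nth _ 5) //; apply: eq_form => i.
by case: i => [[|[|[|[|[|[|i]]]]]] //= lt_i6]; rewrite /c; congr (a _);
   apply: val_inj; rewrite /= inordK.
Qed.

Lemma meval_dform_cons c (l : seq k) x :
  (dform (c :: l)).@[x] = c * x ord0 ^+ size l + x ord_max * (dform l).@[x].
Proof.
by rewrite [dform _]/= mevalD mevalZ mevalM /X2 /Y2 rmorphXn /= !mevalXU.
Qed.

Lemma meval_dform_nil x : (dform ([::] : seq k)).@[x] = 0.
Proof. exact: meval0. Qed.

Definition meval_dform := (meval_dform_cons, meval_dform_nil).

(** Put p1 = (x2 - x3)(X - x1 Y), and p2, p3 cyclically; then p1 + p2 + p3 = 0. The rows of [g] are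
    multiples of l1 = w^2 p2 - w p1 and l2 = p1 - w^2 p2, for which l1 + l2, l1 + w l2 and l1 + w^2
    l2 are 1 - w times p1, w^2 p2 and w p3. So l1^3 + l2^3 is (1 - w)^3 p1 p2 p3, a multiple of the
    cubic. *)
Lemma cubic_normal_form (b0 b1 b2 b3 : k) : b0 != 0 ->
  (b1 * b2) ^+ 2 - 4 * b0 * b2 ^+ 3 - 4 * b1 ^+ 3 * b3
    - 27 * (b0 * b3) ^+ 2 + 18 * b0 * b1 * b2 * b3 != 0 ->
  exists (g : 'M[k]_2) (m : k), [/\ \det g = 1, m != 0 &
    dform [:: b0; b1; b2; b3] = m *: substf g (dform slice_cubic)].
Proof.
move=> b0_neq0; have [x1 [x2 [x3 [-> -> ->]]]] := cubic_factor b1 b2 b3 b0_neq0.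
have [e eE] : exists e, e = (x2 - x3) * (x3 - x1) * (x1 - x2) by eexists.
set disc := (X in X != 0); have -> : disc = b0 ^+ 4 * e ^+ 2 by rewrite /disc eE; ring.
rewrite mulf_eq0 !expf_eq0 /= negb_or => /andP[_ e_neq0].
have [w w0] := cube_root_of_unity.
have w2 : w ^+ 2 = - w - 1 by rewrite -[LHS]addr0 -[X in _ + X]oppr0 -w0; ring.
have three_neq0 : (3 : k) != 0 := natr_neq0 char0 2.
have /andP[w1_neq0 w2_neq0] : (1 - w != 0) && (2 + w != 0).
  by rewrite -negb_or -mulf_eq0; suff -> : (1 - w) * (2 + w) = 3 by []; ring: w2.
(* (2 + w) e is the determinant of the matrix with rows l1 and l2; dividing its entries by a square
   root [c] makes it 1. *)
have [c Ec] := closed_sqrt ((2 + w) * e).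
have c_neq0 : c != 0.
  by apply: contraNneq (mulf_neq0 w2_neq0 e_neq0) => c0; rewrite -Ec c0 expr0n.
pose g00 := w ^+ 2 * (x3 - x1) - w * (x2 - x3).
pose g01 := w * (x2 - x3) * x1 - w ^+ 2 * (x3 - x1) * x2.
pose g10 := (x2 - x3) - w ^+ 2 * (x3 - x1).
pose g11 := w ^+ 2 * (x3 - x1) * x2 - (x2 - x3) * x1.
pose g : 'M[k]_2 := \matrix_(i, j) (c^-1 *
  (if i == ord0 then if j == ord0 then g00 else g01
   else if j == ord0 then g10 else g11)).
exists g, (b0 * c ^+ 3 / ((1 - w) ^+ 3 * e)); split.
- rewrite det_mx22 !mxE /=.
  transitivity ((g00 * g11 - g01 * g10) / c ^+ 2); first by field.
  suff -> : g00 * g11 - g01 * g10 = c ^+ 2 by rewrite divff ?expf_neq0.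
  by rewrite Ec /g00 /g01 /g10 /g11 eE; ring: w2.
- rewrite !(mulf_eq0, invr_eq0, expf_eq0) /= !negb_or.
  by rewrite b0_neq0 c_neq0 w1_neq0 e_neq0.
apply: (mpoly_fun_eq char0) => x.
rewrite mevalZ meval_substf !meval_dform /= !big_ord_recl !big_ord0 !mxE /=.
have -> : lift ord0 ord0 = ord_max :> 'I_2 by apply: val_inj.
move: (x ord0) (x ord_max) => X Y.
transitivity (b0 / ((1 - w) ^+ 3 * e) *
  ((g00 * X + g01 * Y) ^+ 3 + (g10 * X + g11 * Y) ^+ 3)); last first.
  by field; rewrite ?c_neq0 ?w1_neq0 ?e_neq0.
have -> : (g00 * X + g01 * Y) ^+ 3 + (g10 * X + g11 * Y) ^+ 3 =
    (1 - w) ^+ 3 * e * ((X - x1 * Y) * (X - x2 * Y) * (X - x3 * Y)).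
  by rewrite /g00 /g01 /g10 /g11 eE; ring: w2.
by field; rewrite ?e_neq0 ?w1_neq0.
Qed.

Lemma substf_invmx (g : 'M[k]_2) A : \det g = 1 -> substf g (substf (invmx g) A) = A.
Proof.
move=> det1; have g_unit : g \in unitmx by rewrite unitmxE det1 unitr1.
apply: (mpoly_fun_eq char0) => x; rewrite !meval_substf; apply: meval_eq => i.
have <- : \sum_j (1%:M : 'M[k]_2) i j * x j = x i.
  rewrite (bigD1 i) //= mxE eqxx mul1r big1 ?addr0 // => j ne_ji.
  by rewrite mxE eq_sym (negbTE ne_ji) mul0r.
rewrite -(mulVmx g_unit); under [RHS]eq_bigr do rewrite mxE mulr_suml.
rewrite exchange_big; apply: eq_bigr => j _; rewrite mulr_sumr.
by apply: eq_bigr => l _; rewrite mulrA.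
Qed.

Lemma normal_form (v : 'I_(6 + 4) -> k) :
  let b i := v (rshift 6 (inord i)) in
  b 0%N != 0 ->
  (b 1%N * b 2%N) ^+ 2 - 4 * b 0%N * b 2%N ^+ 3 - 4 * b 1%N ^+ 3 * b 3%N
    - 27 * (b 0%N * b 3%N) ^+ 2 + 18 * b 0%N * b 1%N * b 2%N * b 3%N != 0 ->
  exists g s p u w v' z m, \det g = 1 /\
    v =1 (fun i => m * subst_pair g (slice s p u w v' z) i).
Proof.
move=> b b0_neq0 disc_neq0.
have [g [m [det1 m_neq0 Eg]]] := cubic_normal_form b0_neq0 disc_neq0.
have cubicE : cubic v = dform [:: b 0%N; b 1%N; b 2%N; b 3%N].
  rewrite -(@form_nth _ 3) //; apply: eq_form => i.
  by case: i => [[|[|[|[|i]]]] //= lt_i4]; rewrite /b; congr (v (rshift 6 _));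
    apply: val_inj; rewrite /= inordK.
(* The scalar [m] found for the cubic must serve the quintic too, so the quintic is divided by it
   once carried back by the inverse of [g]. *)
have [s [p [u [w [v' [z E]]]]]] := slice_quintic_onto
  (fun i => m^-1 * subst_pair (invmx g) v (lshift 4 i)).
exists g, s, p, u, w, v', z, m; split=> //; apply: eq_pair.
  rewrite quinticZ quintic_subst quintic_slice -E formZ.
  rewrite -[form _]/(quintic (subst_pair (invmx g) v)) quintic_subst.
  by rewrite /substf linearZ /= -/(substf _ _) substf_invmx // scalerA divff ?scale1r.
by rewrite cubicZ cubic_subst cubic_slice -Eg cubicE.
Qed.

(** By [normal_form], [P] vanishes unless the leading coefficient or the discriminant of the cubic
    does; both are nonzero polynomials in a domain. *)
Lemma slice_dense d (P : {mpoly k[6 + 4]}) : P \is d.-homog -> SL2_invariant P ->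
  (forall s p u w v z, P.@[slice s p u w v z] = 0) -> P = 0.
Proof.
move=> hP invP P0; pose B i : {mpoly k[6 + 4]} := 'X_(rshift 6 (inord i)).
pose disc := (B 1%N * B 2%N) ^+ 2 - 4%:MP * B 0%N * B 2%N ^+ 3
    - 4%:MP * B 1%N ^+ 3 * B 3%N - 27%:MP * (B 0%N * B 3%N) ^+ 2
    + 18%:MP * B 0%N * B 1%N * B 2%N * B 3%N.
have discE v : let b i := v (rshift 6 (inord i)) in disc.@[v] =
  (b 1%N * b 2%N) ^+ 2 - 4 * b 0%N * b 2%N ^+ 3 - 4 * b 1%N ^+ 3 * b 3%N
    - 27 * (b 0%N * b 3%N) ^+ 2 + 18 * b 0%N * b 1%N * b 2%N * b 3%N.
  move=> b; rewrite /disc /B.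
  by rewrite !(mevalC, mevalXU, mevalM, rmorphXn (meval v), mevalB, mevalD).
have disc_neq0 : disc != 0.
  (* At G_0 the discriminant is -27. Truncated subtraction gives every quintic coefficient the value
     1, which [disc] does not see. *)
  apply/eqP => disc0; have := discE (fun i => (nth 0 slice_cubic (i - 6))).
  rewrite disc0 meval0 /= !inordK //= => /esym/eqP; apply/negP.
  have -> : (0 * 0) ^+ 2 - 4 * 1 * 0 ^+ 3 - 4 * 0 ^+ 3 * 1 - 27 * (1 * 1) ^+ 2 +
    18 * 1 * 0 * 0 * 1 = - 27 :> k by ring.
  by rewrite oppr_eq0; apply: (natr_neq0 char0 26).
suff : P * B 0%N * disc = 0.
  move/eqP; rewrite !mulf_eq0 (negbTE disc_neq0) orbF => /orP[/eqP //|].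
  rewrite -msupp_eq0 msuppX //.
apply: (mpoly_fun_eq0 char0) => v; rewrite !mevalM discE mevalXU.
have [b0|b0] := eqVneq (v (rshift 6 (inord 0))) 0; first by rewrite b0 mulr0 mul0r.
set D := (X in _ * X); have [->|D0] := eqVneq D 0; first by rewrite mulr0.
have [g [s [p [u [w [v' [z [m [det1 Ev]]]]]]]]] := normal_form b0 D0.
by rewrite (meval_eq _ Ev) (meval_homog _ _ hP) invP // P0 mulr0 !mul0r.
Qed.

End NormalForm.

(** * Invariants of the slice *)

Section SliceInvariants.
Variable k : closedFieldType.
Hypothesis char0 : [pchar k] =i pred0.

Record point := Point { cs : k; cp : k; cu : k; cw : k; cv : k; cz : k }.
Implicit Types t : point.

Definition slice_at t : 'I_(6 + 4) -> k :=
  slice (cs t) (cp t) (cu t) (cw t) (cv t) (cz t).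

Definition I2 t := cu t * cw t.
Definition I3 t := cu t ^+ 3 + cw t ^+ 3.
Definition I4 t := cu t * cz t + cv t * cw t.
Definition I5 t := cu t ^+ 2 * cv t + cw t ^+ 2 * cz t.
Definition alt t := cu t ^+ 3 - cw t ^+ 3.
Definition I6 t := cp t * alt t.

Definition psi_seq t : seq k :=
  [:: 280 / 3 * cs t; 120050%:B / 27 * I2 t; (245 / 9) ^+ 3 * I3 t;
      - (24010%:B / 9 * I2 t) - 192080%:B * I4 t;
      - (2941225%:B / 81 * I3 t) - 47059600%:B / 9 * I5 t;
      - (411771500%:B / 27 * I6 t)].

(* The values of [U_1, ..., U_6] on the slice. *)
Definition psi t (i : 'I_6) : k := (psi_seq t)`_i.

Lemma posr_neq0 p : posr p != 0 :> k.
Proof.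
rewrite -[posr p]/(binr (Npos p)) binrE; have /pcharf0P -> := char0.
by elim: p => //= p; rewrite NatTrec.doubleE double_eq0.
Qed.

Local Notation Pol := {mpoly k[6]}.
Let X j : Pol := 'X_(inord j).

Let psiE t j : (j < 6)%N -> (X j).@[psi t] = (psi_seq t)`_j.
Proof. by move=> lt_j6; rewrite mevalXU /psi inordK. Qed.

Ltac nonzero := do ?[apply/andP; split];
  first [assumption | exact: oner_neq0 | exact: natr_neq0].

(** The identities below hold for arbitrary nonzero constants, so the literals become variables and
    [field] need not expand them. *)
Ltac abstract_posr := repeat match goal with |- context [posr ?p] =>
  let H := fresh in have H := posr_neq0 p; move: (posr p) H => ? H end.

Let mE := (mevalC, mevalM, mevalN, mevalB, mevalD).

(** [psi_seq] is a triangular linear change of [cs], [I2], ..., [I6], inverted in this and the next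
    five lemmas. The sigma type lets each polynomial be named and used through its specification
    alone. *)
Lemma J1_exists : {J : Pol | forall t, J.@[psi t] = cs t}.
Proof.
exists ((3 / 280)%:MP * X 0) => t.
rewrite !mE !psiE //=  /binr; abstract_posr; field; nonzero.
Qed.
Let J1 := sval J1_exists.
Let J1E : forall t, J1.@[psi t] = cs t := svalP J1_exists.

Lemma J2_exists : {J : Pol | forall t, J.@[psi t] = I2 t}.
Proof.
exists ((27 / 120050%:B)%:MP * X 1) => t.
rewrite !mE !psiE //=  /binr; abstract_posr; field; nonzero.
Qed.
Let J2 := sval J2_exists.
Let J2E : forall t, J2.@[psi t] = I2 t := svalP J2_exists.

Lemma J3_exists : {J : Pol | forall t, J.@[psi t] = I3 t}.
Proof.
exists (((9 / 245) ^+ 3)%:MP * X 2) => t.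
rewrite !mE !psiE //=  /binr; abstract_posr; field; nonzero.
Qed.
Let J3 := sval J3_exists.
Let J3E : forall t, J3.@[psi t] = I3 t := svalP J3_exists.

Lemma J4_exists : {J : Pol | forall t, J.@[psi t] = I4 t}.
Proof.
exists (- (192080%:B^-1)%:MP * (X 3 + (24010%:B / 9)%:MP * J2)) => t.
rewrite !mE !psiE //= J2E /binr; abstract_posr; field; nonzero.
Qed.
Let J4 := sval J4_exists.
Let J4E : forall t, J4.@[psi t] = I4 t := svalP J4_exists.

Lemma J5_exists : {J : Pol | forall t, J.@[psi t] = I5 t}.
Proof.
exists (- (9 / 47059600%:B)%:MP * (X 4 + (2941225%:B / 81)%:MP * J3)) => t.
rewrite !mE !psiE //= J3E /binr; abstract_posr; field; nonzero.
Qed.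
Let J5 := sval J5_exists.
Let J5E : forall t, J5.@[psi t] = I5 t := svalP J5_exists.

Lemma J6_exists : {J : Pol | forall t, J.@[psi t] = I6 t}.
Proof.
exists (- (27 / 411771500%:B)%:MP * X 5) => t.
rewrite !mE !psiE //=  /binr; abstract_posr; field; nonzero.
Qed.
Let J6 := sval J6_exists.
Let J6E : forall t, J6.@[psi t] = I6 t := svalP J6_exists.

(** A common denominator for all reductions: division by 2 I2 expresses u^2 through w and w^2
    through u, and division by alt yields p, v and z. The square makes it invariant under the
    swap. *)
Definition delta t := 2 * I2 t * alt t ^+ 2.

(** The discriminant of the quadratic with roots u^3 and w^3. *)
Lemma Jdisc_exists : {J : Pol | forall t, J.@[psi t] = alt t ^+ 2}.
Proof.
exists (J3 ^+ 2 - 4%:MP * J2 ^+ 3) => t.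
rewrite !(mE, rmorphXn (meval _)) /= J2E J3E /I2 /I3 /alt; ring.
Qed.
Let Jdisc := sval Jdisc_exists.
Let JdiscE : forall t, Jdisc.@[psi t] = alt t ^+ 2 := svalP Jdisc_exists.

Lemma Jdelta_exists : {J : Pol | forall t, J.@[psi t] = delta t}.
Proof. by exists (2%:MP * J2 * Jdisc) => t; rewrite !mE JdiscE J2E. Qed.
Let Jdelta := sval Jdelta_exists.
Let JdeltaE : forall t, Jdelta.@[psi t] = delta t := svalP Jdelta_exists.

(* [psi] is the quotient map by the group of order 6 generated by [rotate] and
   [swap] below; away from [delta = 0] the functions on the slice are a free module
   over the invariants, with basis 1, alt, u, u alt, w, w alt. *)
Definition combination (x0 y0 x1 y1 x2 y2 : Pol) t :=
  x0.@[psi t] + y0.@[psi t] * alt t +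
  (x1.@[psi t] + y1.@[psi t] * alt t) * cu t +
  (x2.@[psi t] + y2.@[psi t] * alt t) * cw t.

(** Membership in the localized module, stated on points with the powers of [delta] cleared, so that
    no localization is constructed. *)
Definition decomposable (f : point -> k) := exists N x0 y0 x1 y1 x2 y2,
  forall t, delta t ^+ N * f t = combination x0 y0 x1 y1 x2 y2 t.

Lemma decomposable_ext f g : f =1 g -> decomposable f -> decomposable g.
Proof.
move=> eq_fg [N [x0 [y0 [x1 [y1 [x2 [y2 H]]]]]]].
by exists N, x0, y0, x1, y1, x2, y2 => t; rewrite -eq_fg.
Qed.

Lemma decomposable_const c : decomposable (fun=> c).
Proof.
exists 0%N, c%:MP, 0, 0, 0, 0, 0 => t.
rewrite /combination !mevalC; ring.
Qed.

Lemma decomposableD f g :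
  decomposable f -> decomposable g -> decomposable (fun t => f t + g t).
Proof.
move=> [N [x0 [y0 [x1 [y1 [x2 [y2 H]]]]]]] [N' [x0' [y0' [x1' [y1' [x2' [y2' H']]]]]]].
exists (N + N')%N, (Jdelta ^+ N' * x0 + Jdelta ^+ N * x0'),
  (Jdelta ^+ N' * y0 + Jdelta ^+ N * y0'), (Jdelta ^+ N' * x1 + Jdelta ^+ N * x1'),
  (Jdelta ^+ N' * y1 + Jdelta ^+ N * y1'), (Jdelta ^+ N' * x2 + Jdelta ^+ N * x2'),
  (Jdelta ^+ N' * y2 + Jdelta ^+ N * y2') => t.
transitivity (delta t ^+ N' * (delta t ^+ N * f t) + delta t ^+ N * (delta t ^+ N' * g t)).
  by rewrite exprD; ring.
rewrite H H' /combination !(mE, rmorphXn (meval _)) /= JdeltaE; ring.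
Qed.

(** The reductions are u w = I2, delta u^2 = alt^2 (I3 + alt) w and delta w^2 = alt^2 (I3 - alt) u;
    the last two cost the extra factor [delta]. *)
Lemma decomposableM f g :
  decomposable f -> decomposable g -> decomposable (fun t => f t * g t).
Proof.
move=> [N [x0 [y0 [x1 [y1 [x2 [y2 H]]]]]]] [N' [x0' [y0' [x1' [y1' [x2' [y2' H']]]]]]].
(* In the product, a + b alt is the coefficient of w^2 and a1 + b1 alt that of u^2. *)
pose a := x2 * x2' + y2 * y2' * Jdisc; pose b := x2 * y2' + y2 * x2'.
pose a1 := x1 * x1' + y1 * y1' * Jdisc; pose b1 := x1 * y1' + y1 * x1'.
exists (N + N').+1,
  (Jdelta * (x0 * x0' + y0 * y0' * Jdisc +
     J2 * (x1 * x2' + y1 * y2' * Jdisc + x2 * x1' + y2 * y1' * Jdisc))),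
  (Jdelta * (x0 * y0' + y0 * x0' + J2 * (x1 * y2' + y1 * x2' + x2 * y1' + y2 * x1'))),
  (Jdelta * (x0 * x1' + y0 * y1' * Jdisc + x1 * x0' + y1 * y0' * Jdisc)
     + Jdisc * (a * J3 - b * Jdisc)),
  (Jdelta * (x0 * y1' + y0 * x1' + x1 * y0' + y1 * x0') + Jdisc * (b * J3 - a)),
  (Jdelta * (x0 * x2' + y0 * y2' * Jdisc + x2 * x0' + y2 * y0' * Jdisc)
     + Jdisc * (a1 * J3 + b1 * Jdisc)),
  (Jdelta * (x0 * y2' + y0 * x2' + x2 * y0' + y2 * x0') + Jdisc * (b1 * J3 + a1)) => t.
transitivity (delta t * ((delta t ^+ N * f t) * (delta t ^+ N' * g t))).
  by rewrite exprS exprD; ring.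
rewrite H H' /combination /a /b /a1 /b1 !mE !JdeltaE !JdiscE !J2E !J3E.
rewrite /delta /I2 /I3 /alt; ring.
Qed.

Lemma decomposable_cs : decomposable cs.
Proof.
by exists 0%N, J1, 0, 0, 0, 0, 0 => t; rewrite /combination J1E ?meval0; ring.
Qed.

Lemma decomposable_cu : decomposable cu.
Proof.
by exists 0%N, 0, 0, 1, 0, 0, 0 => t; rewrite /combination ?meval1 ?meval0; ring.
Qed.

Lemma decomposable_cw : decomposable cw.
Proof.
by exists 0%N, 0, 0, 0, 0, 1, 0 => t; rewrite /combination ?meval1 ?meval0; ring.
Qed.

Lemma decomposable_cp : decomposable cp.
Proof.
exists 1%N, 0, (2%:MP * J2 * J6), 0, 0, 0, 0 => t.
by rewrite /combination ?meval0 !mE J2E J6E /delta /I6; ring.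
Qed.

(* Cramer's rule for the linear system [I4 = u z + v w], [I5 = u^2 v + w^2 z]. *)
Lemma decomposable_cv : decomposable cv.
Proof.
exists 1%N, 0, 0, (J4 * Jdisc), (2%:MP * J2 * J5 - J4 * J3), 0, 0 => t.
rewrite /combination ?meval0 !mE J2E J3E J4E J5E JdiscE.
rewrite /delta /I2 /I3 /I4 /I5 /alt; ring.
Qed.

(** Mirror image of [decomposable_cv] under u <-> w, v <-> z, which changes the sign of alt. *)
Lemma decomposable_cz : decomposable cz.
Proof.
exists 1%N, 0, 0, 0, 0, (J4 * Jdisc), (J4 * J3 - 2%:MP * J2 * J5) => t.
rewrite /combination ?meval0 !mE J2E J3E J4E J5E JdiscE.
rewrite /delta /I2 /I3 /I4 /I5 /alt; ring.
Qed.

Lemma decomposable_slice (P : {mpoly k[6 + 4]}) :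
  decomposable (fun t => P.@[slice_at t]).
Proof.
elim/mpoly_ring_ind: P => [c|i|P Q hP hQ|P Q hP hQ].
- by apply: (decomposable_ext _ (decomposable_const c)) => t; rewrite mevalC.
- pose f t := (slice_quintic (cs t) (cp t) (cu t) (cw t) (cv t) (cz t) ++ slice_cubic k)`_i.
  apply: (@decomposable_ext f) => [t|]; first by rewrite mevalXU.
  have C := decomposable_const; have D := decomposableD; have M := decomposableM.
  have N g : decomposable g -> decomposable (fun t => - g t).
    by move/(M _ _ (C (-1))); apply: decomposable_ext => t; rewrite mulN1r.
  rewrite /f; case: i {f} => [[|[|[|[|[|[|[|[|[|[|i]]]]]]]]]] //= lt_i] /=;
    do ?[exact: C | exact: decomposable_cs | exact: decomposable_cp
       | exact: decomposable_cu | exact: decomposable_cw | exact: decomposable_cv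
       | exact: decomposable_cz | apply: D | apply: M | apply: N ].
- by apply: (decomposable_ext _ (decomposableD hP hQ)) => t; rewrite mevalD.
by apply: (decomposable_ext _ (decomposableM hP hQ)) => t; rewrite mevalM.
Qed.

End SliceInvariants.

(** * Action of S_3 and descent of quotients of invariants *)

Section InvariantQuotients.
Variable k : closedFieldType.
Hypothesis char0 : [pchar k] =i pred0.
Implicit Types t : point k.

Definition rotate (w : k) t :=
  Point (cs t) (cp t) (w ^+ 2 * cu t) (w * cw t) (w ^+ 2 * cv t) (w * cz t).

Definition swap t := Point (cs t) (- cp t) (cw t) (cu t) (cz t) (cv t).

Let ord_max2 : lift ord0 ord0 = ord_max :> 'I_2. Proof. exact: val_inj. Qed.

Section Rotation.
Variable w : k.
Hypothesis w3 : w ^+ 3 = 1.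

Lemma alt_rotate t : alt (rotate w t) = alt t.
Proof. by rewrite /alt /=; ring: w3. Qed.

Lemma psi_rotate t : psi (rotate w t) =1 psi t.
Proof.
move=> i; rewrite /psi /psi_seq /I6 alt_rotate /=.
have -> : I2 (rotate w t) = I2 t by rewrite /I2 /=; ring: w3.
have -> : I3 (rotate w t) = I3 t by rewrite /I3 /=; ring: w3.
have -> : I4 (rotate w t) = I4 t by rewrite /I4 /=; ring: w3.
by have -> : I5 (rotate w t) = I5 t by rewrite /I5 /=; ring: w3.
Qed.

Lemma delta_rotate t : delta (rotate w t) = delta t.
Proof. by rewrite /delta alt_rotate /I2 /=; ring: w3. Qed.

(** The matrix diag(w, w^2) has determinant w^3 = 1 and fixes G_0. *)
Lemma invariant_rotate (P : {mpoly k[6 + 4]}) t : SL2_invariant P ->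
  P.@[slice_at (rotate w t)] = P.@[slice_at t].
Proof.
move=> invP; pose g : 'M[k]_2 := \matrix_(i, j)
  (if i == j then if i == ord0 then w else w ^+ 2 else 0).
rewrite -[RHS](invP g) => [|]; last by rewrite det_mx22 !mxE /=; ring: w3.
apply: meval_eq; apply: eq_pair; rewrite ?quintic_subst ?cubic_subst /slice_at
  !(quintic_slice, cubic_slice); apply: (mpoly_fun_eq char0) => x;
  rewrite meval_substf !meval_dform /= !big_ord_recl !big_ord0 !mxE /= ord_max2;
  ring: w3.
Qed.

End Rotation.

Lemma alt_swap t : alt (swap t) = - alt t.
Proof. by rewrite /alt opprB. Qed.

Lemma psi_swap t : psi (swap t) =1 psi t.
Proof.
move=> i; rewrite /psi /psi_seq /I6 alt_swap /= mulrNN.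
have -> : I2 (swap t) = I2 t by rewrite /I2 mulrC.
have -> : I3 (swap t) = I3 t by rewrite /I3 addrC.
have -> : I4 (swap t) = I4 t by rewrite /I4 /= addrC [_ * cu t]mulrC [cw t * _]mulrC.
by have -> : I5 (swap t) = I5 t by rewrite /I5 addrC.
Qed.

Lemma delta_swap t : delta (swap t) = delta t.
Proof. by rewrite /delta alt_swap sqrrN /I2 [cu _ * _]mulrC. Qed.

(** The substitution x -> j y, y -> j x has determinant -j^2 = 1 and carries the pair at [t] to -j
    times the pair at [swap t]. *)
Lemma invariant_swap d (P : {mpoly k[6 + 4]}) j t : j ^+ 2 = -1 ->
  P \is d.-homog -> SL2_invariant P ->
  P.@[slice_at t] = (- j) ^+ d * P.@[slice_at (swap t)].
Proof.
move=> j2 hP invP; pose g : 'M[k]_2 := \matrix_(i, l) (if i == l then 0 else j).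
rewrite -[LHS](invP g) => [|]; last by rewrite det_mx22 !mxE /=; ring: j2.
rewrite -(meval_homog _ _ hP).
apply: meval_eq; apply: eq_pair; rewrite ?quinticZ ?cubicZ ?quintic_subst ?cubic_subst
  /slice_at !(quintic_slice, cubic_slice); apply: (mpoly_fun_eq char0) => x;
  rewrite mevalZ meval_substf !meval_dform /= !big_ord_recl !big_ord0 !mxE /= ord_max2;
  ring: j2.
Qed.

(** Summing over the three rotations kills the u and w parts, which are multiplied by nontrivial
    characters: 1 + w + w^2 = 0. *)
Lemma invariant_combination (P : {mpoly k[6 + 4]}) : SL2_invariant P ->
  exists N (x y : {mpoly k[6]}), forall t,
    delta t ^+ N * P.@[slice_at t] = x.@[psi t] + y.@[psi t] * alt t.
Proof.
move=> invP; have [N [x0 [y0 [x1 [y1 [x2 [y2 H]]]]]]] := decomposable_slice char0 P.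
have [w w0] := cube_root_of_unity k.
have w2 : w ^+ 2 = - w - 1 by rewrite -[LHS]addr0 -[X in _ + X]oppr0 -w0; ring.
have w3 : w ^+ 3 = 1 by rewrite exprS w2; ring: w2.
have w6 : (w ^+ 2) ^+ 3 = 1 by rewrite -exprM mulnC exprM w3 expr1n.
exists N, x0, y0 => t.
have three_neq0 : (3 : k) != 0 := natr_neq0 char0 2.
apply: (mulfI three_neq0).
have := H (rotate w t); have := H (rotate (w ^+ 2) t); have := H t.
rewrite !delta_rotate // !invariant_rotate // /combination !alt_rotate //.
rewrite !(meval_eq _ (psi_rotate w3 t)) !(meval_eq _ (psi_rotate w6 t)) /=.
set A := delta t ^+ N * _; set X0 := x0.@[_] + _; set X1 := x1.@[_] + _.
set X2 := x2.@[_] + _ => E1 E2 E3.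
transitivity (A + A + A); first by ring.
by rewrite {1}E1 {1}E2 E3; ring: w2.
Qed.

(** P/Q is rationalized by the swapped Q, whose alt part has the opposite sign. The last clause will
    give B != 0, since Q and its swap vanish together. *)
Lemma psi_quotient d (P Q : {mpoly k[6 + 4]}) :
  P \is d.-homog -> SL2_invariant P -> Q \is d.-homog -> SL2_invariant Q ->
  exists A B : {mpoly k[6]},
    (forall t, P.@[slice_at t] * B.@[psi t] = Q.@[slice_at t] * A.@[psi t]) /\
    (B = 0 -> forall t, delta t * Q.@[slice_at t] = 0).
Proof.
move=> hP invP hQ invQ.
have [N [x [y Ep]]] := invariant_combination invP.
have [N' [x' [y' Eq]]] := invariant_combination invQ.
have [j j2] := closed_sqrt (-1 : k).
have two_neq0 : (2 : k) != 0 := natr_neq0 char0 1.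
have j_neq0 : - j != 0.
  rewrite oppr_eq0; apply: contraTneq isT => j0; move/eqP: j2.
  by rewrite j0 expr0n /= eq_sym oppr_eq0 oner_eq0.
have [Jd Ed] := Jdelta_exists char0; have [Ja Ea] := Jdisc_exists char0.
(* The powers of [Jd] balance the denominators: delta^(N + N') above and delta^(2 N') below. *)
exists ((x * x' - y * y' * Ja) * Jd ^+ N'), ((x' ^+ 2 - y' ^+ 2 * Ja) * Jd ^+ N).
have Ep' t : delta t ^+ N * P.@[slice_at (swap t)] = x.@[psi t] - y.@[psi t] * alt t.
  have := Ep (swap t); rewrite delta_swap alt_swap !(meval_eq _ (psi_swap t)) => ->.
  by rewrite mulrN.
have Eq' t : delta t ^+ N' * Q.@[slice_at (swap t)] = x'.@[psi t] - y'.@[psi t] * alt t.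
  have := Eq (swap t); rewrite delta_swap alt_swap !(meval_eq _ (psi_swap t)) => ->.
  by rewrite mulrN.
have Ps t := invariant_swap t j2 hP invP; have Qs t := invariant_swap t j2 hQ invQ.
have cross t : P.@[slice_at t] * Q.@[slice_at (swap t)] =
    P.@[slice_at (swap t)] * Q.@[slice_at t] by rewrite (Ps t) (Qs t); ring.
have AE t : (x * x' - y * y' * Ja).@[psi t] =
    delta t ^+ N * delta t ^+ N' * (P.@[slice_at t] * Q.@[slice_at (swap t)]).
  (* Twice the product equals, by [cross], its sum with its image under the swap, where the terms
     odd in alt cancel. *)
  apply: (mulfI two_neq0).
  transitivity (delta t ^+ N * P.@[slice_at t] * (delta t ^+ N' * Q.@[slice_at (swap t)])
    + delta t ^+ N * P.@[slice_at (swap t)] * (delta t ^+ N' * Q.@[slice_at t])).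
    by rewrite Ep Ep' Eq Eq' mevalB !mevalM Ea; ring.
  transitivity (delta t ^+ N * delta t ^+ N' * (P.@[slice_at t] * Q.@[slice_at (swap t)])
    + delta t ^+ N * delta t ^+ N' * (P.@[slice_at (swap t)] * Q.@[slice_at t])).
    by ring.
  by rewrite -cross; ring.
have BE t : (x' ^+ 2 - y' ^+ 2 * Ja).@[psi t] =
    delta t ^+ N' * delta t ^+ N' * (Q.@[slice_at t] * Q.@[slice_at (swap t)]).
  transitivity (delta t ^+ N' * Q.@[slice_at t] * (delta t ^+ N' * Q.@[slice_at (swap t)])).
    by rewrite Eq Eq' mevalB (rmorphXn (meval _)) mevalM !(rmorphXn (meval _)) /= Ea; ring.
  by ring.
split=> [t|B0 t].
  by rewrite ![(_ * Jd ^+ _).@[_]]mevalM AE BE !(rmorphXn (meval _)) /= Ed; ring.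
have := congr1 (meval (psi t)) B0.
rewrite mevalM BE (rmorphXn (meval _)) /= Ed meval0 => /eqP.
rewrite !mulf_eq0 !expf_eq0.
have [->|d_neq0] := eqVneq (delta t) 0; first by rewrite mul0r.
rewrite !andbF /= orbF => /orP[/eqP->|/eqP Q0]; first by rewrite mulr0.
by rewrite (Qs t) Q0 !mulr0.
Qed.

(* [u^3] and [w^3] are the two roots of [X^2 - I3 X + I2^3]. *)
Lemma psi_onto : exists2 disc : {mpoly k[6]}, disc != 0 &
  forall z : 'I_6 -> k, disc.@[z] != 0 -> exists t, psi t =1 z.
Proof.
pose X j : {mpoly k[6]} := 'X_(inord j).
pose c2 : k := 27 / 120050%:B; pose c3 : k := (9 / 245) ^+ 3.
pose disc : {mpoly k[6]} := c2%:MP * X 1 *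
  ((c3%:MP * X 2) ^+ 2 - 4%:MP * (c2%:MP * X 1) ^+ 3).
have discE z : disc.@[z] = c2 * z (inord 1) *
    ((c3 * z (inord 2)) ^+ 2 - 4 * (c2 * z (inord 1)) ^+ 3).
  by rewrite /disc !(mevalC, mevalXU, mevalM, rmorphXn (meval _), mevalB).
have nz j : posr j != 0 :> k := posr_neq0 char0 j.
have nzn n : n.+1%:R != 0 :> k := natr_neq0 char0 n.
have c2_neq0 : c2 != 0 by rewrite mulf_neq0 ?invr_neq0 ?(nzn 26) ?nz.
have c3_neq0 : c3 != 0 by rewrite expf_neq0 // mulf_neq0 ?invr_neq0 ?(nzn 8) ?(nzn 244).
exists disc.
  (* At this point I2 would be 1 and I3 would be 0, and [disc] is -4. *)
  apply/eqP => disc0; have := discE (fun i : 'I_6 => if i == inord 1 then c2^-1 else 0).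
  rewrite disc0 meval0 eqxx divff //.
  have /negbTE -> : inord 2 != inord 1 :> 'I_6 by rewrite -val_eqE /= !inordK.
  rewrite mulr0 expr0n expr1n sub0r mulr1 mul1r => /esym/eqP.
  by rewrite oppr_eq0; apply/negP; apply: (nzn 3).
move=> z; rewrite discE; set e := c2 * _; set f := c3 * _.
rewrite mulf_eq0 negb_or => /andP[e_neq0 disc_neq0].
have [r Er] := closed_quadratic f (- e ^+ 3).
have r_neq0 : r != 0.
  apply: contraNneq e_neq0 => r0; move/esym/eqP: Er.
  by rewrite r0 expr0n mulr0 add0r oppr_eq0 expf_eq0.
have [u Eu] := closed_cbrt r.
have u_neq0 : u != 0 by apply: contraNneq r_neq0 => u0; rewrite -Eu u0 expr0n.
pose w := e / u.
have Ew : w ^+ 3 = f - r.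
  apply: (mulIf r_neq0); rewrite mulrBl -[r * r]expr2 Er /w -Eu; field.
  exact: u_neq0.
have Ealt : u ^+ 3 - w ^+ 3 != 0.
  apply: contraNneq disc_neq0; rewrite Ew Eu => Efr.
  have Ef : f = 2 * r by rewrite -[LHS]addr0 -Efr; ring.
  have -> : e ^+ 3 = f * r - r ^+ 2 by rewrite Er; ring.
  by apply/eqP; rewrite Ef; ring.
(* [g4], [g5], [g6] are the values required of I4, I5, I6; then v and z come from Cramer's rule with
   determinant [d]. *)
pose g4 := - (z (inord 3) + 24010%:B / 9 * e) / 192080%:B.
pose g5 := - (z (inord 4) + 2941225%:B / 81 * f) / (47059600%:B / 9).
pose g6 := - z (inord 5) / (411771500%:B / 27).
pose d := u ^+ 3 - w ^+ 3.
exists (Point (z (inord 0) * 3 / 280) (g6 / d) u w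
  ((u * g5 - w ^+ 2 * g4) / d) ((u ^+ 2 * g4 - w * g5) / d)).
have I2E : u * w = e by rewrite /w mulrCA divff ?mulr1.
have I3E : u ^+ 3 + w ^+ 3 = f by rewrite Eu Ew addrC subrK.
move=> i; rewrite /psi /psi_seq /I2 /I3 /I4 /I5 /I6 /alt /= I2E I3E -/d.
have -> : u * ((u ^+ 2 * g4 - w * g5) / d) + (u * g5 - w ^+ 2 * g4) / d * w = g4.
  by rewrite /d; field.
have -> : u ^+ 2 * ((u * g5 - w ^+ 2 * g4) / d) +
    w ^+ 2 * ((u ^+ 2 * g4 - w * g5) / d) = g5.
  by rewrite /d; field.
rewrite (divfK Ealt).
rewrite /g4 /g5 /g6 /e /f /c2 /c3 /binr.
(* With [z] written as a list, the claim becomes six separate equations. *)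
have -> : z i = [seq z (inord j) | j <- iota 0 6]`_i.
  by rewrite (nth_map 0%N) ?size_iota // nth_iota // add0n inord_val.
congr (_`_i); rewrite /=.
do ?[match goal with |- context [posr ?p] =>
  let H := fresh in have H := nz p; move: (posr p) H => ? H end].
congr [:: _; _; _; _; _; _]; field; do ?[apply/andP; split];
  first [assumption | exact: nzn].
Qed.

End InvariantQuotients.

(** * Morphisms out of a field of fractions *)

Section FractionMorphism.
Variables (R : idomainType) (L : fieldType) (h : {rmorphism R -> L}).
Hypothesis h_inj : injective h.

(** Boolean, so that [xchoose] can extract a representative. *)
Lemma fractionP (x : {fraction R}) : exists nd : R * R,
  (nd.2 != 0) && (x == tofrac nd.1 / tofrac nd.2).
Proof.
elim/quotW: x => -[[n d] /= d_neq0]; exists (n, d); rewrite d_neq0 /=.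
have d0 : tofrac d != 0 by rewrite tofrac_eq0.
apply/eqP/(mulIf d0); rewrite divfK //.
rewrite !piE; apply/eqP; rewrite eqmodE /= FracField.equivfE /FracField.mulf.
by rewrite !numden_Ratio ?mulr1 ?oner_neq0 // mulrC.
Qed.

Definition fraction_lift (x : {fraction R}) : L :=
  let nd := xchoose (fractionP x) in h nd.1 / h nd.2.

(** Independence of the chosen representative: injectivity of [h] keeps denominators nonzero and
    lets cross-multiplication pass through [h]. *)
Lemma fraction_liftE n d : d != 0 -> fraction_lift (tofrac n / tofrac d) = h n / h d.
Proof.
move=> d_neq0; rewrite /fraction_lift.
case: (xchoose _) (xchooseP (fractionP (tofrac n / tofrac d))) => n' d' /=.
move=> /andP[d'_neq0 /eqP E].
have h0 x : x != 0 -> h x != 0 by rewrite -(rmorph0 h) (inj_eq h_inj).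
apply/eqP; rewrite eqr_div ?h0 // -!rmorphM (inj_eq h_inj) -tofrac_eq !tofracM.
by rewrite -eqr_div ?tofrac_eq0 // E.
Qed.

Lemma fraction_lift_tofrac n : fraction_lift (tofrac n) = h n.
Proof.
by rewrite -[tofrac n]divr1 -tofrac1 fraction_liftE ?oner_neq0 // rmorph1 divr1.
Qed.

Lemma fraction_lift_zmod : zmod_morphism fraction_lift.
Proof.
move=> x y; have [[n d] /= /andP[d0 /eqP->]] := fractionP x.
have [[n' d'] /= /andP[d'0 /eqP->]] := fractionP y.
have h0 z : z != 0 -> h z != 0 by rewrite -(rmorph0 h) (inj_eq h_inj).
rewrite -mulNr -tofracN addf_div ?tofrac_eq0 // -!tofracM -tofracD.
rewrite !fraction_liftE ?mulf_neq0 // -mulNr addf_div ?h0 //.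
by rewrite rmorphD !rmorphM rmorphN.
Qed.

Lemma fraction_lift_monoid : monoid_morphism fraction_lift.
Proof.
split=> [|x y]; first by rewrite -tofrac1 fraction_lift_tofrac rmorph1.
have [[n d] /= /andP[d0 /eqP->]] := fractionP x.
have [[n' d'] /= /andP[d'0 /eqP->]] := fractionP y.
rewrite mulf_div -!tofracM !fraction_liftE ?mulf_neq0 // mulf_div.
by rewrite !rmorphM.
Qed.

HB.instance Definition _ := 
  GRing.isZmodMorphism.Build _ _ fraction_lift fraction_lift_zmod.
HB.instance Definition _ := 
  GRing.isMonoidMorphism.Build _ _ fraction_lift fraction_lift_monoid.

Definition fraction_morphism : {rmorphism {fraction R} -> L} := fraction_lift.

End FractionMorphism.

(** * The function field *)

Section FunctionField.
Variable k : closedFieldType.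
Hypothesis char0 : [pchar k] =i pred0.

Local Notation S := {mpoly k[6 + 4]}.
Local Notation K := {fraction S}.
Local Notation Pol := {mpoly k[6]}.

Definition D : S := jD (genG k).
Definition Num (i : 'I_6) : S := tnth (P_ (genF k) (genG k)) i.

Lemma coef_homog_gen n (f : 'I_n.+1 -> 'I_(6 + 4)) :
  coef_homog 1 (form (fun i => 'X_(f i) : S)).
Proof.
move=> m; rewrite /form raddf_sum /=; apply: rpred_sum => i _.
rewrite mcoeffZ mcoeffX; apply: (@dhomogM _ _ _ 1 _ 0).
  by rewrite dhomogX; apply/eqP/mdeg1.
exact: natr_homog.
Qed.

Let homF : coef_homog 1 (genF k) := coef_homog_gen (lshift 4).
Let homG : coef_homog 1 (genG k) := coef_homog_gen (fun i : 'I_4 => rshift 6 i).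

Lemma D_homog : D \is 4.-homog.
Proof. exact: jD_homog homG. Qed.

Lemma Num_homog i : Num i \is (4 * tnth m_ i).-homog.
Proof. exact: P_homog homF homG i. Qed.

Let fact_unitS n : (n`!%:R : S) \is a GRing.unit.
Proof.
rewrite -mpolyC_nat; apply/unitrP; exists ((n`!%:R : k)^-1)%:MP.
have f_neq0 : n`!%:R != 0 :> k.
  by rewrite -(prednK (fact_gt0 n)) (natr_neq0 char0).
by rewrite -!mpolyCM mulVf // mulfV.
Qed.

Let eval_gen (v : 'I_(6 + 4) -> k) :
  (map_mpoly (meval v) (genF k) = quintic v) * (map_mpoly (meval v) (genG k) = cubic v).
Proof.
by split; rewrite /genF /genG /quintic /cubic map_form; apply: eq_form => i /=;
   rewrite mevalXU.
Qed.

Lemma meval_D v : D.@[v] = jD (cubic v).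
Proof. by rewrite -(jD_map (meval v) fact_unitS) eval_gen. Qed.

Lemma meval_Num i v : (Num i).@[v] = tnth (P_ (quintic v) (cubic v)) i.
Proof. by rewrite -(P_map (meval v) fact_unitS) !eval_gen. Qed.

Lemma D_invariant : SL2_invariant D.
Proof. move=> g v det1; rewrite [LHS]meval_D [RHS]meval_D cubic_subst.
exact: (jD_substf det1). Qed.

Lemma Num_invariant i : SL2_invariant (Num i).
Proof.
move=> g v det1; rewrite [LHS]meval_Num [RHS]meval_Num quintic_subst cubic_subst.
exact: (P_substf det1).
Qed.

Definition ck (i : 'I_6) : k :=
  [:: 3%:B; 54%:B; 20432412%:B; 18%:B; 2270268%:B; 27027%:B]`_i.

Lemma D_slice t : D.@[slice_at t] = - 2.
Proof.
by rewrite meval_D cubic_slice (jD_slice (natr_neq0 char0)).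
Qed.

Lemma Num_slice i t :
  (Num i).@[slice_at t] = ck i * (- 2) ^+ tnth m_ i * psi t i.
Proof.
rewrite meval_Num quintic_slice cubic_slice.
case: i => [[|[|[|[|[|[|i]]]]]] lt_i6] //; rewrite !(tnth_nth 0) /ck /psi /psi_seq /=.
- exact: (P1_slice (natr_neq0 char0)).
- exact: (P2_slice (natr_neq0 char0)).
- exact: (P3_slice (natr_neq0 char0)).
- exact: (P4_slice (natr_neq0 char0)).
- exact: (P5_slice (natr_neq0 char0)).
exact: (P6_slice (natr_neq0 char0)).
Qed.

End FunctionField.

(** * Generation, independence and birationality *)

Section Birationality.
Variable k : closedFieldType.
Hypothesis char0 : [pchar k] =i pred0.

Local Notation S := {mpoly k[6 + 4]}.
Local Notation K := {fraction S}.
Local Notation Pol := {mpoly k[6]}.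
Local Notation den := (tofrac (D k)).

Lemma two_neq0 : (-2 : k) != 0.
Proof. by rewrite oppr_eq0 (natr_neq0 char0 1). Qed.

Lemma D_neq0 : D k != 0.
Proof.
apply/eqP => D0; have := D_slice char0 (Point 0 0 0 0 0 0).
by rewrite D0 meval0 => /eqP; rewrite eq_sym (negbTE two_neq0).
Qed.

Let den_neq0 : den != 0. Proof. by rewrite tofrac_eq0 D_neq0. Qed.

Lemma invariantD (P Q : S) : SL2_invariant P -> SL2_invariant Q -> SL2_invariant (P + Q).
Proof. by move=> hP hQ g v det1; rewrite !mevalD hP ?hQ. Qed.

Lemma invariantB (P Q : S) : SL2_invariant P -> SL2_invariant Q -> SL2_invariant (P - Q).
Proof. by move=> hP hQ g v det1; rewrite !mevalB hP ?hQ. Qed.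

Lemma invariantM (P Q : S) : SL2_invariant P -> SL2_invariant Q -> SL2_invariant (P * Q).
Proof. by move=> hP hQ g v det1; rewrite !mevalM hP ?hQ. Qed.

Lemma invariantX (P : S) e : SL2_invariant P -> SL2_invariant (P ^+ e).
Proof. by move=> hP g v det1; rewrite !(rmorphXn (meval _)) /= hP. Qed.

Lemma invariantC c : SL2_invariant (c%:MP : S).
Proof. by move=> g v _; rewrite !mevalC. Qed.

(** [scalar] bundled as a ring morphism, so that [evalU] is one too. *)
Let const : {rmorphism k -> K} := @tofrac S \o @mpolyC (6 + 4) k.

Definition evalU : {rmorphism Pol -> K} := mmap const (U k).

Lemma evalUE p : evalK (U k) p = evalU p.
Proof. by []. Qed.

Lemma evalU_const c : evalU c%:MP = tofrac (c%:MP : S).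
Proof. exact: mmapC. Qed.

Lemma evalU_var i : evalU 'X_i = U k i.
Proof. by rewrite /evalU /= mmapX mmap1U. Qed.

Lemma ck_neq0 i : ck k i != 0.
Proof.
by case: i => [[|[|[|[|[|[|i]]]]]] lt_i6] //; rewrite /ck /=; apply: (posr_neq0 char0).
Qed.

Lemma UE i : U k i = tofrac ((ck k i)^-1%:MP * Num k i) / den ^+ tnth m_ i.
Proof.
have cE : tnth (c_ k) i = tofrac ((ck k i)%:MP : S).
  have E n : (binr n : K) = tofrac ((binr n : k)%:MP : S).
    by rewrite !binrE mpolyC_nat rmorph_nat.
  by case: i => [[|[|[|[|[|[|i]]]]]] lt_i6] //; rewrite (tnth_nth 0) /ck /=; apply: E.
have c0 : tofrac ((ck k i)%:MP : S) != 0 by rewrite tofrac_eq0 mpolyC_eq0 ck_neq0.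
rewrite /U cE tofracM mulrA; congr (_ * _ / _); apply: (mulfI c0).
by rewrite divff // -tofracM -mpolyCM divff ?ck_neq0 // mpolyC1 tofrac1.
Qed.

(* Clearing denominators, a polynomial in the [U i] becomes an honest invariant. *)
Lemma evalU_invariant p : exists e (P : S),
  [/\ P \is (4 * e).-homog, SL2_invariant P, evalU p = tofrac P / den ^+ e
    & forall t, P.@[slice_at t] = (- 2) ^+ e * p.@[psi t]].
Proof.
elim/mpoly_ring_ind: p => [c|i|p q [e [P [hP iP EP sP]]] [f [Q [hQ iQ EQ sQ]]]
  |p q [e [P [hP iP EP sP]]] [f [Q [hQ iQ EQ sQ]]]].
- exists 0%N, c%:MP; split=> [||| t].
  + by rewrite -[_%:MP]mulr1 mul_mpolyC dhomogZ ?dhomog1.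
  + exact: invariantC.
  + by rewrite evalU_const expr0 divr1.
  by rewrite !mevalC mul1r.
- exists (tnth m_ i), ((ck k i)^-1%:MP * Num k i); split=> [||| t].
  + by rewrite mul_mpolyC dhomogZ ?Num_homog.
  + by apply: invariantM; [apply: invariantC | apply: Num_invariant].
  + by rewrite evalU_var UE.
  by rewrite mevalM mevalC (Num_slice char0) mevalXU -!mulrA mulKf ?ck_neq0.
- exists (e + f)%N, (P * D k ^+ f + Q * D k ^+ e); split=> [||| t].
  + have hD n : D k ^+ n \is (4 * n).-homog by apply: dhomogMn; apply: D_homog.
    by apply: rpredD; [apply: (homogM hP (hD f)) | apply: (homogM hQ (hD e))]; lia.
  + by apply: invariantD; apply: invariantM => //; apply: invariantX; apply: D_invariant.
  + rewrite rmorphD EP EQ addf_div ?expf_neq0 // -exprD.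
    by rewrite tofracD !tofracM !tofracXn.
  rewrite mevalD !mevalM !(rmorphXn (meval _)) /= (D_slice char0) sP sQ mevalD exprD.
  by ring.
exists (e + f)%N, (P * Q); split=> [||| t].
+ by rewrite mulnDr; apply: dhomogM.
+ exact: invariantM.
+ by rewrite rmorphM EP EQ mulf_div -exprD tofracM.
by rewrite !mevalM sP sQ exprD; ring.
Qed.

(** A relation among the [U i] vanishes on the image of [psi], which by [psi_onto] contains the
    complement of a hypersurface. *)
Lemma evalU_inj : injective evalU.
Proof.
suff ker p : evalU p = 0 -> p = 0.
  by move=> p q eq_pq; apply/subr0_eq/ker; rewrite rmorphB eq_pq subrr.
have [disc disc_neq0 onto] := psi_onto char0.
have [e [P [_ _ -> sP]]] := evalU_invariant p.
move/eqP; rewrite mulf_eq0 invr_eq0 expf_eq0 (negbTE den_neq0) andbF orbF.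
rewrite tofrac_eq0 => /eqP P0.
suff /eqP : p * disc = 0 by rewrite mulf_eq0 (negbTE disc_neq0) orbF => /eqP.
apply: (mpoly_fun_eq0 char0) => z; rewrite mevalM.
have [->|/onto[t Et]] := eqVneq disc.@[z] 0; first by rewrite mulr0.
have := sP t; rewrite P0 meval0 (meval_eq _ Et) => /esym/eqP.
by rewrite mulf_eq0 expf_eq0 (negbTE two_neq0) andbF => /eqP->; rewrite mul0r.
Qed.

Lemma generated_absolute f : generated_field (U k) f -> absolute_invariant f.
Proof.
move=> [p [q [q_neq0 ->]]]; rewrite !evalUE in q_neq0 *.
have [e [P [hP iP EP _]]] := evalU_invariant p.
have [e' [Q [hQ iQ EQ _]]] := evalU_invariant q.
(* Crossing the powers of [D] clears the denominators and equalizes the degrees. *)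
exists (4 * e + 4 * e')%N, (P * D k ^+ e'), (Q * D k ^+ e).
have iD n : SL2_invariant (D k ^+ n) by apply: invariantX; apply: D_invariant.
have hD n : D k ^+ n \is (4 * n).-homog by apply: dhomogMn; apply: D_homog.
have Q_neq0 : Q != 0.
  by apply: contraNneq q_neq0 => Q0; rewrite EQ Q0 tofrac0 mul0r.
split.
- by split; [apply: dhomogM | apply: invariantM].
- by split; [apply: (homogM hQ (hD e)); rewrite addnC | apply: invariantM].
- by rewrite mulf_neq0 ?expf_neq0 ?D_neq0.
rewrite EP EQ invf_div mulf_div !tofracM !tofracXn; congr (_ / _).
by rewrite mulrC.
Qed.

Lemma absolute_generated f : absolute_invariant f -> generated_field (U k) f.
Proof.
move=> [d [P [Q [[hP iP] [hQ iQ] Q_neq0 ->]]]].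
have [A [B [AB B0]]] := psi_quotient char0 hP iP hQ iQ.
have iD n : SL2_invariant (D k ^+ n) by apply: invariantX; apply: D_invariant.
have hD n : D k ^+ n \is (4 * n).-homog by apply: dhomogMn; apply: D_homog.
(* If B = 0 then delta Q vanishes on the slice. There delta is, up to a power of -2, the restriction
   of a nonzero invariant [V], so Q V = 0 by [slice_dense]. *)
have B_neq0 : B != 0.
  apply: contraNneq Q_neq0 => /B0 dQ.
  have [J JE] := Jdelta_exists char0.
  have J_neq0 : J != 0.
    apply/eqP => J0; have := JE (Point 0 0 1 2 0 0); rewrite J0 meval0 /delta /I2 /alt /=.
    have -> : 2 * (1 * 2) * (1 ^+ 3 - 2 ^+ 3) ^+ 2 = 196 :> k by ring.
    by move/esym/eqP; apply/negP; apply: (natr_neq0 char0 195).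
  have [e [V [hV iV EV sV]]] := evalU_invariant J.
  have V_neq0 : V != 0.
    apply: contraNneq J_neq0 => V0; apply/eqP/evalU_inj.
    by rewrite EV V0 tofrac0 mul0r rmorph0.
  suff /eqP : Q * V = 0 by rewrite mulf_eq0 (negbTE V_neq0) orbF.
  apply: (slice_dense char0 (dhomogM hQ hV) (invariantM iQ iV)) => s p u w v z.
  have := dQ (Point s p u w v z); rewrite -JE mevalM => E.
  by have := sV (Point s p u w v z); rewrite {1}/slice_at /= => ->;
    rewrite mulrCA [_ * J.@[_]]mulrC E mulr0.
exists A, B; rewrite !evalUE.
have [a [A' [hA iA EA sA]]] := evalU_invariant A.
have [b [B' [hB iB EB sB]]] := evalU_invariant B.
have evB : evalU B != 0 by rewrite -(rmorph0 evalU) (inj_eq evalU_inj).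
split=> //; rewrite EA EB.
have B'_neq0 : B' != 0 by apply: contraNneq evB => B0'; rewrite EB B0' tofrac0 mul0r.
rewrite invf_div mulf_div; apply/eqP.
rewrite eqr_div ?mulf_neq0 ?expf_neq0 ?tofrac_eq0 ?D_neq0 //.
rewrite -!tofracXn -!tofracM tofrac_eq; apply/eqP/subr0_eq.
(* Both cross products are invariants of this degree, so comparing them on the slice suffices; there
   the identity is [AB] times a power of -2. *)
apply: (slice_dense char0 (d := d + (4 * a + 4 * b))) => [||s p u w v z].
- apply: rpredB.
    exact: (dhomogM hP (dhomogM (hD a) hB)).
  exact: (homogM (dhomogM hA (hD b)) hQ (addnC _ _)).
- by apply: invariantB; do ?[apply: invariantM => //].
pose t := Point s p u w v z; rewrite -[slice _ _ _ _ _ _]/(slice_at t).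
rewrite mevalB !mevalM !(rmorphXn (meval _)) /= (D_slice char0) sA sB.
apply/eqP; rewrite subr_eq0; apply/eqP.
transitivity ((- 2) ^+ a * (- 2) ^+ b * (P.@[slice_at t] * B.@[psi t])); first by ring.
by rewrite AB; ring.
Qed.

Lemma U_absolute i : absolute_invariant (U k i).
Proof.
apply: generated_absolute; exists 'X_i, 1; rewrite !evalUE rmorph1 oner_neq0.
by rewrite divr1 evalU_var.
Qed.

Lemma birational_U : birational_coordinates (U k).
Proof.
exists (fraction_morphism evalU_inj); split.
- by move=> c; apply: etrans (fraction_lift_tofrac evalU_inj _) (evalU_const c).
- by move=> i; apply: etrans (fraction_lift_tofrac evalU_inj _) (evalU_var i).
- exact: fmorph_inj.
move=> f; split=> [/absolute_generated [p [q [q_neq0 ->]]]|[g <-]].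
  have q0 : q != 0 by apply: contraNneq q_neq0 => ->; rewrite evalUE rmorph0.
  by exists (tofrac p / tofrac q); exact: (fraction_liftE evalU_inj p q0).
apply: generated_absolute; have [[p q] /= /andP[q0 /eqP->]] := fractionP g.
exists p, q; rewrite !evalUE; split; last exact: (fraction_liftE evalU_inj p q0).
by rewrite -(rmorph0 evalU) (inj_eq evalU_inj).
Qed.

End Birationality.

Theorem theorem5p4 (k : closedFieldType) (char0 : [pchar k] =i pred0) :
  [/\ forall i : 'I_6, absolute_invariant (U k i),
      forall f : {fraction {mpoly k[6 + 4]}},
        function_field_M41 f <-> generated_field (U k) f,
      algebraically_independent (U k)
    & birational_coordinates (U k)].
Proof.
split.
- exact: U_absolute.
- by move=> f; split; [apply: absolute_generated | apply: generated_absolute].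
- by move=> p p0; apply: (evalU_inj char0); rewrite -evalUE p0 rmorph0.
exact: birational_U.
Qed.
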